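(* The capacity region $\mathcal{C}^{f}_{gmac-dms}$ of the two-user Gaussian multiple-access channel with degraded message sets and noiseless feedback described in the context, with power constraints $P_1,P_2>0$ and noise variance $\sigma_1^2>0$, equals the no-feedback capacity region \[ \bigcup_{0\le\rho\le1}\Big\{(R_1\ge0,R_2\ge0):\ R_2\le\tfrac12\log\Big(1+\tfrac{P_2(1-\rho^2)}{\sigma_1^2}\Big),\ R_1+R_2\le\tfrac12\log\Big(1+\tfrac{P_1+P_2+2\sqrt{P_1P_2}\rho}{\sigma_1^2}\Big)\Big\}. \]
   Context: All logarithms are base 2. Channel (GMAC-DMS with feedback): for $i=1,\dots,N$, $Y_i=X_{1,i}+X_{2,i}+\eta_{1,i}$, where $\eta_{1,i}\sim\mathcal N(0,\sigma_1^2)$ are i.i.d. and independent of the messages. Messages $W_1,W_2$ are independent, $W_j$ uniform on $\{1,\dots,|\mathcal W_j|\}$. $X_{1,i}$ is a function of $W_1$ and the noiseless feedback $Y^{i-1}$; $X_{2,i}$ is a function of $W_1$, $W_2$ and $Y^{i-1}$. Power constraints: $\frac1N\sum_{i=1}^N E[X_{j,i}^2]\le P_j$. The receiver outputs $(\hat W_1,\hat W_2)=\psi(Y^N)$; $P_e$ is the average probability that $\psi(Y^N)\neq(W_1,W_2)$. A pair $(R_1,R_2)$ is achievable if for every $\epsilon>0$ and all sufficiently large $N$ there exist encoders and a decoder with $\frac{\log|\mathcal W_j|}{N}=R_j$ ($j=1,2$) and $P_e\le\epsilon$. $\mathcal{C}^{f}_{gmac-dms}$ is the set of all achievable pairs.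
   Formalization: Achievability is taken with log|W_j|/N ≥ R_j (R_j ≥ 0) instead of log|W_j|/N = R_j, since exact equality for all large N would exclude rates such as R_2 = 1/2 and make the claim false; encoders and decoder are assumed measurable. *)

(* Defs.v *)
From HB Require Import structures.
From mathcomp Require Import all_boot all_order all_algebra.
From mathcomp Require Import all_classical all_reals all_analysis.
Set Implicit Arguments. Unset Strict Implicit. Unset Printing Implicit Defensive.
Import Order.TTheory GRing.Theory Num.Theory.
Local Open Scope classical_set_scope.
Local Open Scope ring_scope.

Section GMAC_DMS.
Context {R : realType}.

Definition log2 (x : R) : R := ln x / ln 2.

(** A feedback code of block length N with message sets 'I_M1, 'I_M2.
    At time i (i = 0, ..., N-1), the past outputs Y^{i} (i values) form an
    i.-tuple; encoder 1 sees (W1, Y^i), encoder 2 sees (W1, W2, Y^i);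
    the decoder sees Y^N. *)
Record fb_code (N M1 M2 : nat) := FbCode {
  enc1 : forall i : nat, 'I_M1 -> i.-tuple R -> R;
  enc2 : forall i : nat, 'I_M1 -> 'I_M2 -> i.-tuple R -> R;
  dec  : N.-tuple R -> 'I_M1 * 'I_M2 }.

Arguments enc1 {N M1 M2} f i _ _.
Arguments enc2 {N M1 M2} f i _ _ _.
Arguments dec {N M1 M2} f _.
Definition fb_code_measurable N M1 M2 (c : fb_code N M1 M2) : Prop :=
  (forall i w1, measurable_fun [set: i.-tuple R] (enc1 c i w1)) /\
  (forall i w1 w2, measurable_fun [set: i.-tuple R] (enc2 c i w1 w2)) /\
  (forall w, measurable (dec c @^-1` [set w])).

(** Channel outputs Y^n (as an n.-tuple) for messages (w1, w2) and noise
    realization z (z i = eta_{i+1}):  Y_i = X_{1,i} + X_{2,i} + eta_i. *)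
Fixpoint outputs N M1 M2 (c : fb_code N M1 M2) (w1 : 'I_M1) (w2 : 'I_M2)
    (z : nat -> R) (n : nat) : n.-tuple R :=
  match n return n.-tuple R with
  | 0 => [tuple]
  | n'.+1 =>
      let ys := outputs c w1 w2 z n' in
      [tuple of rcons ys (enc1 c n' w1 ys + enc2 c n' w1 w2 ys + z n')]
  end.

Definition input1 N M1 M2 (c : fb_code N M1 M2) w1 w2 (z : nat -> R) (i : nat)
  : R := enc1 c i w1 (outputs c w1 w2 z i).
Definition input2 N M1 M2 (c : fb_code N M1 M2) w1 w2 (z : nat -> R) (i : nat)
  : R := enc2 c i w1 w2 (outputs c w1 w2 z i).

(** Expectation of a nonnegative functional of n i.i.d. N(0, s^2) noise
    samples (the n-fold product of the normal probability), computed as an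
    iterated integral (Tonelli). *)
Fixpoint gauss_expect (s : R) (n : nat) : (n.-tuple R -> \bar R) -> \bar R :=
  match n return (n.-tuple R -> \bar R) -> \bar R with
  | 0 => fun F => F [tuple]
  | n'.+1 => fun F =>
      (\int[normal_prob 0 s]_x gauss_expect s (fun t => F [tuple of x :: t]))%E
  end.

Definition noise_fun n (t : n.-tuple R) : nat -> R := fun i => nth 0 t i.

Definition avg_msgs M1 M2 (s : R) N
    (G : 'I_M1 -> 'I_M2 -> N.-tuple R -> \bar R) : \bar R :=
  (((M1 * M2)%:R)^-1)%:E *
  (\sum_(w1 < M1) \sum_(w2 < M2) gauss_expect s (G w1 w2))%E.

Definition error_prob N M1 M2 (s : R) (c : fb_code N M1 M2) : \bar R :=
  avg_msgs s (fun w1 w2 (z : N.-tuple R) =>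
    ((dec c (outputs c w1 w2 (noise_fun z) N) != (w1, w2))%:R)%:E).

Definition avg_power1 N M1 M2 (s : R) (c : fb_code N M1 M2) : \bar R :=
  ((N%:R)^-1)%:E *
  (\sum_(i < N) avg_msgs s (fun w1 w2 (z : N.-tuple R) =>
      ((input1 c w1 w2 (noise_fun z) i) ^+ 2)%:E))%E.
Definition avg_power2 N M1 M2 (s : R) (c : fb_code N M1 M2) : \bar R :=
  ((N%:R)^-1)%:E *
  (\sum_(i < N) avg_msgs s (fun w1 w2 (z : N.-tuple R) =>
      ((input2 c w1 w2 (noise_fun z) i) ^+ 2)%:E))%E.

(** Achievability (noise std. deviation s, i.e. variance s^2). *)
Definition achievable (P1 P2 s R1 R2 : R) : Prop :=
  0 <= R1 /\ 0 <= R2 /\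
  forall eps : R, 0 < eps ->
  exists N0 : nat, forall N : nat, (N0 <= N)%N -> (0 < N)%N ->
  exists (M1 M2 : nat) (c : fb_code N M1 M2),
    (0 < M1)%N /\ (0 < M2)%N /\
    R1 <= log2 M1%:R / N%:R /\ R2 <= log2 M2%:R / N%:R /\
    fb_code_measurable c /\
    (avg_power1 s c <= P1%:E)%E /\ (avg_power2 s c <= P2%:E)%E /\
    (error_prob s c <= eps%:E)%E.

Definition capacity_region_fb (P1 P2 s : R) : set (R * R) :=
  [set r | achievable P1 P2 s r.1 r.2].

Definition nofb_region (P1 P2 s : R) : set (R * R) :=
  [set r | exists rho : R, [/\ 0 <= rho <= 1, 0 <= r.1, 0 <= r.2,
     r.2 <= 2^-1 * log2 (1 + P2 * (1 - rho ^+ 2) / s ^+ 2) &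
     r.1 + r.2 <= 2^-1 * log2 (1 + (P1 + P2 + 2 * Num.sqrt (P1 * P2) * rho)
                                    / s ^+ 2)]].

End GMAC_DMS.

(* Main.v *)
(** Converse. For a reference measure [Q] under which the messages are hidden
from the receiver, integrating [1 + (g + ln L) <= expR (g + ln L)] with
[L = dQ/dP] and [g = ln M] on correct decoding gives
[(1 - eps) ln M <= 1 + D(P || Q)].  Choosing [Q] to be the output law of a
channel with input [m] and a larger noise variance turns [D(P || Q)] into a
quadratic expression in the inputs: [m = 0] bounds the sum rate, and
[m = (1 + a) X1] for a suitable [a] bounds the rate of message 2.  Both bounds hold for a
common [rho], and a maximum argument over [rho] in [[0, 1]] removes [eps].

Achievability. Feedback allows a deterministic Schalkwijk-Kailath scheme: two
scalar estimation errors, one per message, are refined linearly at every step.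
Their second moments are invariant after rescaling, so Chebyshev's inequality
alone bounds the error probability by a quantity decaying geometrically below
capacity.  Boundary points are reached because the power is averaged over the
messages: giving up a small fraction of the messages of user 1 frees power for
the others. *)
Require Import Defs.
From HB Require Import structures.
From mathcomp Require Import all_boot all_order all_algebra.
From mathcomp Require Import all_classical all_reals all_analysis.
From mathcomp Require Import measurable_realfun ring lra.
Import Order.TTheory GRing.Theory Num.Theory.
Local Open Scope classical_set_scope.
Local Open Scope ring_scope.

Set Implicit Arguments.
Unset Strict Implicit.
Unset Printing Implicit Defensive.

(** * Gaussian integrals *)

Section Gaussian.
Context {R : realType}.
Implicit Types (s x m : R) (f : R -> \bar R).
Local Notation mu := (@lebesgue_measure R).

(** [gauss_expect] is an iterated integral, so the expectations are kept to nonnegative integrands,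
    where Tonelli, linearity and monotonicity hold with no integrability conditions. This shapes
    many statements: the correlation of the two inputs is not integrated but recovered from energies
    of linear combinations, and inequalities are arranged with nonnegative terms on both sides.

    Feedback does not help in the converse because each noise sample is independent of the outputs
    before it: whatever the policies [x] and [m], the mean of [(x - m + z)^2] exceeds that of
    [(x - m)^2] by exactly [s^2]. If the reference variance is [s^2 + T], with [T] the power allowed
    for [x - m], the quadratic terms of the divergence add up to at most their value at capacity,
    and only [n * ln (s' / s)] remains.

    In the scheme, the error of message 1 is refined as if the part carrying message 2 were noise,
    whereas the recursion for message 2 first removes the part carrying message 1. The second user
    splits its power between helping message 1 coherently and sending message 2. *)

Lemma ge0_integral_shift (a : R) f : measurable_fun [set: R] f ->
  (forall x, 0 <= f x)%E -> (\int[mu]_x f (x + a)%R = \int[mu]_x f x)%E.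
Proof.
move=> mf f0.
pose sh : R -> measurableTypeR R := fun x => x + a.
have ma : measurable_fun [set: R] sh by exact: measurable_funD.
have -> : (\int[mu]_x f x)%E = (\int[pushforward mu sh]_x f x)%E.
  apply: eq_measure_integral => A mA _.
  apply: lebesgue_measure_unique => //= _ [[b c]] _ <-.
  rewrite /pushforward.
  have -> : sh @^-1` [set` `]b, c]] = [set` `]b - a, c - a]].
    by apply/seteqP; split => x /=; rewrite !in_itv/= ltrBlDr lerBrDr.
  rewrite !lebesgue_measure_itv/= !lte_fin ltrD2r; case: ifP => // _.
  by rewrite -!EFinB; congr EFin; lra.
by rewrite ge0_integral_pushforward.
Qed.

Lemma ge0_integral_opp f : measurable_fun [set: R] f ->
  (forall x, 0 <= f x)%E -> (\int[mu]_x f (- x)%R = \int[mu]_x f x)%E.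
Proof.
move=> mf f0.
have -> : (\int[mu]_x f x)%E = (\int[pushforward mu (-%R : R -> measurableTypeR R)]_x f x)%E.
  apply: eq_measure_integral => A mA _.
  by apply/esym/lebesgue_measureN.
by rewrite ge0_integral_pushforward.
Qed.

Lemma measurable_pdf m s : measurable_fun [set: R] (fun x => (normal_pdf m s x)%:E).
Proof. by apply/measurable_EFinP; exact: measurable_normal_pdf. Qed.

(** The Radon-Nikodym derivative agrees with [normal_pdf] almost everywhere, since both have the
    same integral over every measurable set. *)
Lemma ge0_integral_normal m s f : measurable_fun [set: R] f ->
  (forall x, 0 <= f x)%E ->
  (\int[normal_prob m s]_x f x = \int[mu]_x ((normal_pdf m s x)%:E * f x))%E.
Proof.
move=> mf f0.
have dom := normal_prob_dominates m s.
have intRN := Radon_Nikodym_SigmaFinite.f_integrable dom.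
rewrite -(Radon_Nikodym_SigmaFinite.change_of_variables dom)//.
apply: ge0_ae_eq_integral => //.
- exact: emeasurable_funM mf (measurable_int _ intRN).
- exact: emeasurable_funM (measurable_pdf _ _) mf.
- by move=> x _; rewrite mule_ge0// Radon_Nikodym_SigmaFinite.f_ge0.
- by move=> x _; rewrite mule_ge0// lee_fin normal_pdf_ge0.
- under [X in ae_eq _ _ _ X]eq_fun do rewrite muleC.
  apply: ae_eqe_mul2l; apply: integral_ae_eq => //.
  + exact: measurable_pdf.
  + by move=> A _ mA; rewrite -Radon_Nikodym_SigmaFinite.f_integral.
Qed.

Lemma normal_pdf_gt0 m s x : s != 0 -> 0 < normal_pdf m s x.
Proof.
by move=> s0; rewrite normal_pdfE// mulr_gt0 ?normal_peak_gt0 ?expR_gt0.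
Qed.

(** Both sides equal the Lebesgue integral of [normal_pdf 0 s' (y - m0) * f y] over the output [y].
    This is a single channel use: input [x0] and noise [s] on the left, reference input [m0] and
    noise [s'] on the right. *)
Lemma normal_change_of_measure s s' (x0 m0 : R) f : s != 0 ->
  measurable_fun [set: R] f -> (forall x, 0 <= f x)%E ->
  (\int[normal_prob 0 s]_z
     ((normal_pdf 0 s' (x0 + z - m0) / normal_pdf 0 s z)%R%:E * f (x0 + z)%R) =
   \int[normal_prob 0 s']_z f (m0 + z)%R)%E.
Proof.
move=> s0 mf f0.
have mshift (a : R) : measurable_fun [set: R] (fun z => a + z).
  exact: measurable_funD.
have ms (a : R) : measurable_fun [set: R] (fun z => f (a + z)).
  exact: (measurableT_comp mf (mshift a)).
have mpdf (a : R) : measurable_fun [set: R] (fun z => normal_pdf 0 s' (z - a)).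
  apply: (measurableT_comp (measurable_normal_pdf _ _)).
  exact: measurable_funB.
have mpx : measurable_fun [set: R] (fun z => normal_pdf 0 s' (x0 + z - m0)).
  exact: (measurableT_comp (mpdf m0) (mshift x0)).
have pdfV_ge0 z : 0 <= normal_pdf 0 s' (x0 + z - m0) / normal_pdf 0 s z.
  by rewrite divr_ge0// normal_pdf_ge0.
have mV : measurable_fun [set: R] (fun z => (normal_pdf 0 s z)^-1).
  apply: continuous_measurable_fun => z; apply: cvgV.
    by rewrite gt_eqF// normal_pdf_gt0.
  exact: (@continuous_normal_pdf R 0 s s0 z).
rewrite ge0_integral_normal//=; last 2 first.
- apply: emeasurable_funM => //; apply/measurable_EFinP.
  exact: measurable_funM.
- by move=> z; rewrite mule_ge0// lee_fin.
rewrite ge0_integral_normal//.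
transitivity (\int[mu]_y ((normal_pdf 0 s' (y - m0)%R)%:E * f y))%E.
  rewrite -(@ge0_integral_shift x0 (fun y => (normal_pdf 0 s' (y - m0)%R)%:E * f y)%E).
  - apply: eq_integral => z _; rewrite muleA -EFinM [in RHS](addrC z).
    by rewrite mulrCA divff ?mulr1// gt_eqF// normal_pdf_gt0.
  - by apply: emeasurable_funM => //; exact/measurable_EFinP.
  - by move=> y; rewrite mule_ge0// lee_fin normal_pdf_ge0.
rewrite -(@ge0_integral_shift m0 (fun y => (normal_pdf 0 s' (y - m0)%R)%:E * f y)%E).
- by apply: eq_integral => z _; rewrite addrK addrC.
- by apply: emeasurable_funM => //; exact/measurable_EFinP.
- by move=> y; rewrite mule_ge0// lee_fin normal_pdf_ge0.
Qed.

Lemma normal_ratioE s s' (y z : R) : 0 < s -> 0 < s' ->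
  normal_pdf 0 s' y / normal_pdf 0 s z =
  expR (ln (s / s') - y ^+ 2 / (2 * s' ^+ 2) + z ^+ 2 / (2 * s ^+ 2)).
Proof.
move=> s0 s'0; have [s_n s'_n] : s != 0 /\ s' != 0 by rewrite !gt_eqF.
have peak (t : R) : 0 < t -> normal_peak t = t^-1 * (Num.sqrt (pi *+ 2))^-1.
  move=> t0; rewrite /normal_peak -mulrnAr sqrtrM ?sqr_ge0// sqrtr_sqr.
  by rewrite gtr0_norm// invfM.
have k0 : (Num.sqrt (pi *+ 2) : R)^-1 != 0.
  by rewrite invr_eq0 gt_eqF// sqrtr_gt0 pmulrn_lgt0// pi_gt0.
rewrite !normal_pdfE// !peak// /normal_fun !subr0.
have e (t u : R) : expR (- t ^+ 2 / (u ^+ 2 *+ 2)) = expR (- (t ^+ 2 / (2 * u ^+ 2))).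
  by rewrite mulNr mulr_natl.
rewrite !e !expRD !expRN lnK ?posrE ?divr_gt0//.
have := expR_gt0 (y ^+ 2 / (2 * s' ^+ 2)); have := expR_gt0 (z ^+ 2 / (2 * s ^+ 2)).
move: (expR (z ^+ 2 / _)) (expR (y ^+ 2 / _)) (Num.sqrt _)^-1 k0 => a b k k0 a0 b0.
by field; rewrite k0 s'_n s_n !gt_eqF.
Qed.

Lemma integral_normal_cst m s (c : \bar R) : (\int[normal_prob m s]_z c = c)%E.
Proof.
rewrite (integral_cst (normal_prob m s))//=.
by rewrite (@probability_setT _ _ _ (normal_prob m s)) mule1.
Qed.

Lemma integral_normal_expR_sqr s s' : 0 < s -> 0 < s' ->
  (\int[normal_prob 0 s]_z
     (expR (ln (s / s') + z ^+ 2 * ((s ^- 2 - s' ^- 2) / 2)))%:E = 1)%E.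
Proof.
move=> s0 s'0; have := @normal_change_of_measure s s' 0 0 (cst 1%E).
rewrite /cst integral_normal_cst => <-//; last by rewrite gt_eqF.
apply: eq_integral => z _; rewrite mule1 normal_ratioE//; congr (expR _)%:E.
by rewrite add0r subr0; field; rewrite !gt_eqF.
Qed.

Lemma measurable_sqr_affine (u k : R) :
  measurable_fun [set: R] (fun z => ((u + k * z) ^+ 2)%:E).
Proof. by apply/measurable_EFinP/measurable_funX/measurable_funD. Qed.

(* Integrating [1 + x <= expR x] for [x = ln (phi_s' / phi_s)] against the law
   [N(0, s^2)], with [s' = s * expR h] and [h] tending to 0 from both sides,
   squeezes the second moment. *)
Lemma normal_second_moment s : 0 < s ->
  (\int[normal_prob 0 s]_z (z ^+ 2)%:E = (s ^+ 2)%:E)%E.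
Proof.
move=> s0.
have msqr : measurable_fun [set: R] (fun z : R => (z ^+ 2)%:E).
  by apply/measurable_EFinP/measurable_funX.
have mexp a b : measurable_fun [set: R] (fun z : R => (expR (a + z ^+ 2 * b))%:E).
  apply/measurable_EFinP; apply: measurableT_comp => //.
  by apply: measurable_funD => //; apply: measurable_funM => //; exact: measurable_funX.
have sq0 (z : R) : 0 <= z ^+ 2 by exact: sqr_ge0.
have sV0 : 0 < s ^- 2 by rewrite invr_gt0 exprn_gt0.
set v := (\int[normal_prob 0 s]_z (z ^+ 2)%:E)%E.
have v0 : (0 <= v)%E by apply: integral_ge0 => z _; rewrite lee_fin.
have affine (a b : R) : 0 <= a -> 0 <= b ->
    (\int[normal_prob 0 s]_z (a + b * z ^+ 2)%:E = a%:E + b%:E * v)%E.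
  move=> a0 b0; under eq_integral do rewrite EFinD EFinM.
  rewrite ge0_integralD//=.
  - by rewrite ge0_integralZl_EFin// ?integral_normal_cst// => z _; rewrite lee_fin.
  - by move=> z _; rewrite mule_ge0// lee_fin.
  - exact: emeasurable_funM.
have maffine a b : measurable_fun [set: R] (fun z => (a + b * z ^+ 2)%:E).
  apply/measurable_EFinP; apply: measurable_funD => //; apply: measurable_funM => //.
have ub (h : R) : 0 < h < 1 -> exists2 x, v = x%:E & x <= s ^+ 2 * (1 + 2 * h).
  move=> /andP[h0 h1]; pose s' := s * expR h.
  have s'0 : 0 < s' by rewrite mulr_gt0// expR_gt0.
  pose k := (s ^- 2 - s' ^- 2) / 2.
  have lnE : ln (s / s') = - h.
    by rewrite /s' invfM mulrA divff ?gt_eqF// mul1r -expRN expRK.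
  have kge : s ^- 2 * (h / (1 + 2 * h)) <= k.
    have -> : k = s ^- 2 * ((1 - expR (- (2 * h))) / 2).
      by rewrite /k /s' exprMn -expRM_natl [(_ * expR _)^-1]invfM expRN; lra.
    rewrite (ler_wpM2l (ltW sV0))//.
    have := expR_ge1Dx (h *+ 2); rewrite -[h *+ 2]mulr_natl => e1.
    have : expR (- (2 * h)) <= (1 + 2 * h)^-1.
      by rewrite expRN lef_pV2 ?posrE ?expR_gt0//; lra.
    have : (1 + 2 * h)^-1 = 1 - 2 * (h / (1 + 2 * h)) by field; lra.
    by set q := h / _; lra.
  have hq0 : 0 < h / (1 + 2 * h) by rewrite divr_gt0//; lra.
  have k0 : 0 < k by apply: lt_le_trans kge; rewrite mulr_gt0.
  (* Here [s' > s] makes the coefficient [k] of [z ^+ 2] positive. The resulting inequality bounds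
     [v] by [h / k] and also rules out [v = +oo]. *)
  have : ((1 - h)%:E + k%:E * v <= 1)%E.
    rewrite -(integral_normal_expR_sqr s0 s'0) -affine; [|lra|exact: ltW].
    apply: ge0_le_integral => //.
    - by move=> z _; rewrite lee_fin addr_ge0//; [lra|rewrite mulr_ge0// ltW].
    - exact: maffine.
    - exact: mexp.
    - move=> z _; rewrite lee_fin lnE; apply: le_trans (expR_ge1Dx _).
      by rewrite -/k; lra.
  case: (v) v0 => [x| |]//; last by rewrite gt0_muley ?lte_fin.
  rewrite -EFinM -EFinD !lee_fin => x0 kx; exists x => //.
  rewrite -(ler_pM2l k0); have : k * x <= h by lra.
  move/le_trans; apply.
  rewrite [leLHS](_ : h = (s ^- 2 * (h / (1 + 2 * h))) * (s ^+ 2 * (1 + 2 * h))); last first.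
    by field; rewrite gt_eqF//=; lra.
  by rewrite ler_wpM2r// mulr_ge0//; lra.
have lb (h : R) : 0 < h < 2^-1 -> ((s ^+ 2 * (1 - 2 * h))%:E <= v)%E.
  move=> /andP[h0 h1]; pose s' := s * expR (- h).
  have s'0 : 0 < s' by rewrite mulr_gt0// expR_gt0.
  pose k := - ((s ^- 2 - s' ^- 2) / 2).
  have lnE : ln (s / s') = h.
    by rewrite /s' invfM mulrA divff ?gt_eqF// mul1r expRN invrK expRK.
  have e1 : 1 + 2 * h <= expR (2 * h) by exact: expR_ge1Dx.
  have e2 : expR (2 * h) <= (1 - 2 * h)^-1.
    rewrite -[2 * h]opprK expRN lef_pV2 ?posrE ?expR_gt0//; last lra.
    by have := expR_ge1Dx (- (2 * h)); lra.
  have kE : k = s ^- 2 * ((expR (2 * h) - 1) / 2).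
    by rewrite /k /s' exprMn -expRM_natl mulrN expRN [(_ / expR _)^-1]invfM invrK; lra.
  have k0 : 0 < k by rewrite kE mulr_gt0// divr_gt0//; lra.
  have kle : k <= s ^- 2 * (h / (1 - 2 * h)).
    rewrite kE (ler_wpM2l (ltW sV0))//.
    have : (1 - 2 * h)^-1 = 1 + 2 * (h / (1 - 2 * h)) by field; lra.
    by move: e2; set q := h / _; lra.
  (* Now [s' < s] and the coefficient of [z ^+ 2] is [- k], so this term is moved to the side of the
     exponential to keep all integrands nonnegative. *)
  have : ((1 + h)%:E <= 1%:E + k%:E * v)%E.
    rewrite -[X in (X + _)%E](integral_normal_expR_sqr s0 s'0).
    rewrite -ge0_integralZl_EFin//; [|by move=> z _; rewrite lee_fin|exact: ltW].
    rewrite -ge0_integralD//=; last 3 first.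
    - exact: mexp.
    - by move=> z _; rewrite mule_ge0// lee_fin// ltW.
    - exact: emeasurable_funM.
    rewrite -(integral_normal_cst 0 s (1 + h)%:E); apply: ge0_le_integral => //.
    - by move=> z _; rewrite lee_fin; lra.
    - by apply: emeasurable_funD; [exact: mexp|exact: emeasurable_funM].
    - move=> z _; rewrite -EFinM -EFinD lee_fin lnE.
      by have := expR_ge1Dx (h + z ^+ 2 * ((s ^- 2 - s' ^- 2) / 2)); rewrite /k; lra.
  case: (v) v0 => [x| |]//; last by move=> _; rewrite leey.
  rewrite -EFinM -EFinD !lee_fin => x0 kx.
  have hx : h <= k * x by lra.
  rewrite -(ler_pM2l k0); apply: le_trans hx.
  rewrite [leRHS](_ : h = (s ^- 2 * (h / (1 - 2 * h))) * (s ^+ 2 * (1 - 2 * h))); last first.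
    by field; rewrite gt_eqF//=; lra.
  by rewrite ler_wpM2r// mulr_ge0//; lra.
have small (e : R) : 0 < e -> exists2 h, 0 < h < 2^-1 & s ^+ 2 * (2 * h) <= e.
  move=> e0; exists (Num.min (4^-1) (e / (2 * s ^+ 2))).
    rewrite lt_min divr_gt0 ?mulr_gt0 ?exprn_gt0// gt_min invr_gt0 ltr0n/=.
    by apply/orP; left; lra.
  rewrite mulrCA; apply: le_trans (_ : 2 * (s ^+ 2 * (e / (2 * s ^+ 2))) <= e).
    by rewrite !ler_wpM2l// ge_min lexx orbT.
  by rewrite le_eqVlt; apply/orP; left; apply/eqP; field; rewrite gt_eqF.
have [x vx _] : exists2 x, v = x%:E & x <= s ^+ 2 * (1 + 2 * 2^-1) by apply: ub; lra.
rewrite vx; congr EFin; apply/eqP; rewrite eq_le; apply/andP; split.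
  apply/ler_addgt0Pr => e /small[h hh he]; have [|y] := ub h; first by lra.
  by rewrite vx => -[<-]; lra.
apply/ler_addgt0Pr => e /small[h hh he]; have := lb h hh.
by rewrite vx lee_fin; lra.
Qed.

(** The law is symmetric, so [u] and [- u] give the same integral, and in their sum the cross term
    cancels pointwise: [z] itself is never integrated. *)
Lemma normal_second_moment_affine s (u k : R) : 0 < s ->
  (\int[normal_prob 0 s]_z ((u + k * z) ^+ 2)%:E = (u ^+ 2 + k ^+ 2 * s ^+ 2)%:E)%E.
Proof.
move=> s0; have sq0 (z : R) : 0 <= z ^+ 2 by exact: sqr_ge0.
have msqr : measurable_fun [set: R] (fun z : R => (z ^+ 2)%:E).
  by apply/measurable_EFinP/measurable_funX.
pose I (w : R) : \bar R := (\int[normal_prob 0 s]_z ((w + k * z) ^+ 2)%:E)%E.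
have I0 w : (0 <= I w)%E by apply: integral_ge0 => z _; rewrite lee_fin.
have IN : I (- u) = I u.
  have sh0 (w z : R) : (0 <= ((w + k * z) ^+ 2)%:E)%E by rewrite lee_fin.
  rewrite /I !ge0_integral_normal//; do ?exact: measurable_sqr_affine.
  rewrite -ge0_integral_opp.
  - apply: eq_integral => z _; congr (_%:E * _%:E)%E; last by ring.
    by rewrite /normal_pdf gt_eqF// /normal_fun !subr0 sqrrN.
  - by apply: emeasurable_funM; [exact: measurable_pdf|exact: measurable_sqr_affine].
  - by move=> z; rewrite mule_ge0 ?lee_fin ?normal_pdf_ge0 ?sqr_ge0.
have : (I u + I (- u)%R = (2 * (u ^+ 2 + k ^+ 2 * s ^+ 2))%:E)%E.
  have sh0 (w z : R) : (0 <= ((w + k * z) ^+ 2)%:E)%E by rewrite lee_fin.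
  rewrite /I -ge0_integralD//=; do ?exact: measurable_sqr_affine.
  transitivity (\int[normal_prob 0 s]_z ((2 * u ^+ 2)%:E + (2 * k ^+ 2)%:E * (z ^+ 2)%:E))%E.
    by apply: eq_integral => z _; rewrite -EFinM -!EFinD; congr EFin; ring.
  rewrite ge0_integralD//=.
  - rewrite integral_normal_cst ge0_integralZl_EFin//.
    + by rewrite normal_second_moment// -EFinM -EFinD mulrDr mulrA.
    + by move=> z _; rewrite lee_fin.
    + by rewrite mulr_ge0// sqr_ge0.
  - by move=> z _; rewrite lee_fin mulr_ge0 ?sqr_ge0.
  - by move=> z _; rewrite mule_ge0// lee_fin// mulr_ge0// sqr_ge0.
  - exact: emeasurable_funM.
rewrite IN -/(I u); case: (I u) (I0 u) => [x| |]//= _.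
by rewrite -EFinD => -[]; move=> h; congr EFin; lra.
Qed.

Lemma normal_second_moment_shift s (u : R) : 0 < s ->
  (\int[normal_prob 0 s]_z ((u + z) ^+ 2)%:E = (u ^+ 2 + s ^+ 2)%:E)%E.
Proof.
move=> s0; have := normal_second_moment_affine u 1 s0; rewrite expr1n mul1r => <-.
by apply: eq_integral => z _; rewrite mul1r.
Qed.

End Gaussian.

(** * Expectation over the noise samples *)

Section Noise.
Context {R : realType}.
Implicit Types (s : R) (F : seq R -> \bar R).

(** Histories of all lengths share the type [seq R], so that a policy can be shifted by its first
    output without casts; measurability is asked on each [n.-tuple R] separately. *)
Definition seq_measurable d (T : measurableType d) (F : seq R -> T) :=
  forall n, measurable_fun [set: n.-tuple R] (fun t => F (tval t)).

Definition noise_expect s n F : \bar R := gauss_expect s (fun t : n.-tuple R => F t).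

Lemma noise_expectS s n F : noise_expect s n.+1 F =
  (\int[normal_prob 0 s]_z noise_expect s n (fun l => F (z :: l)))%E.
Proof. by []. Qed.

Lemma noise_expect_ge0 s n F : (forall l, 0 <= F l)%E -> (0 <= noise_expect s n F)%E.
Proof.
elim: n F => [|n IH] F F0; first exact: F0.
by rewrite noise_expectS; apply: integral_ge0 => z _; exact: IH.
Qed.

(** The parameter space [X] makes the induction possible: each step moves one noise sample from the
    tuple into the parameter, and Tonelli on [X * R] integrates it out. *)
Lemma measurable_noise_expect d (X : measurableType d) s n (F : X -> seq R -> \bar R) :
  (forall x l, 0 <= F x l)%E ->
  measurable_fun [set: X * n.-tuple R] (fun p => F p.1 (tval p.2)) ->
  measurable_fun [set: X] (fun x => noise_expect s n (F x)).
Proof.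
elim: n d X F => [|n IH] d X F F0 mF.
  apply: (measurableT_comp mF (_ : measurable_fun _ (fun x => (x, [tuple])))).
  by apply/measurable_fun_pair => //; exact: measurable_cst.
apply: (@measurable_fun_fubini_tonelli_F _ _ _ _ _ (normal_prob 0 s)
  (fun p : X * R => noise_expect s n (fun l => F p.1 (p.2 :: l)))).
  apply: (IH _ _ (fun (p : X * R) l => F p.1 (p.2 :: l))) => [//|].
  pose h (q : (X * R) * n.-tuple R) : X * n.+1.-tuple R :=
    (q.1.1, [the n.+1.-tuple R of q.1.2 :: q.2]).
  apply: (measurableT_comp mF (_ : measurable_fun _ h)).
  apply/measurable_fun_pair.
    exact: (measurableT_comp measurable_fst measurable_fst).
  by apply: measurable_cons => //; exact: (measurableT_comp measurable_snd measurable_fst).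
by move=> p; exact: noise_expect_ge0.
Qed.

Lemma measurable_noise_expect_cons s n F : (forall l, 0 <= F l)%E ->
  seq_measurable F ->
  measurable_fun [set: R] (fun z => noise_expect s n (fun l => F (z :: l))).
Proof.
move=> F0 mF; apply: (@measurable_noise_expect _ _ s n (fun z l => F (z :: l))) => //.
pose h (q : R * n.-tuple R) := [the n.+1.-tuple R of q.1 :: q.2].
by apply: (measurableT_comp (mF n.+1) (_ : measurable_fun _ h)); exact: measurable_cons.
Qed.

Lemma seq_measurable_cons d (T : measurableType d) (F : seq R -> T) (z : R) :
  seq_measurable F -> seq_measurable (fun l => F (z :: l)).
Proof.
move=> mF n; pose h (t : n.-tuple R) := [the n.+1.-tuple R of z :: t].
by apply: (measurableT_comp (mF n.+1) (_ : measurable_fun _ h)); exact: measurable_cons.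
Qed.

Lemma noise_expectD s n F G : (forall l, 0 <= F l)%E -> (forall l, 0 <= G l)%E ->
  seq_measurable F -> seq_measurable G ->
  (noise_expect s n (fun l => F l + G l) = noise_expect s n F + noise_expect s n G)%E.
Proof.
elim: n F G => [//|n IH] F G F0 G0 mF mG; rewrite !noise_expectS.
rewrite -ge0_integralD//; first last.
- exact: measurable_noise_expect_cons.
- by move=> z _; exact: noise_expect_ge0.
- exact: measurable_noise_expect_cons.
- by move=> z _; exact: noise_expect_ge0.
by apply: eq_integral => z _; rewrite IH//; exact: seq_measurable_cons.
Qed.

Lemma noise_expectZ s n (k : R) F : 0 <= k -> (forall l, 0 <= F l)%E -> seq_measurable F ->
  (noise_expect s n (fun l => k%:E * F l) = k%:E * noise_expect s n F)%E.
Proof.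
move=> k0; elim: n F => [//|n IH] F F0 mF; rewrite !noise_expectS.
rewrite -ge0_integralZl_EFin//; first last.
- exact: measurable_noise_expect_cons.
- by move=> z _; exact: noise_expect_ge0.
by apply: eq_integral => z _; rewrite IH//; exact: seq_measurable_cons.
Qed.

Lemma noise_expect_cst s n (c : \bar R) : noise_expect s n (fun=> c) = c.
Proof.
elim: n => [//|n IH]; rewrite noise_expectS.
by under eq_integral do rewrite IH; rewrite integral_normal_cst.
Qed.

Lemma noise_expect_le s n F G : (forall l, 0 <= F l)%E ->
  (forall l, size l = n -> (F l <= G l)%E) ->
  seq_measurable F -> seq_measurable G ->
  (forall l, 0 <= G l)%E ->
  (noise_expect s n F <= noise_expect s n G)%E.
Proof.
move=> + + + + G0; elim: n F G G0 => [|n IH] F G G0 F0 FG mF mG; first exact: FG.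
rewrite !noise_expectS; apply: ge0_le_integral => //.
- by move=> z _; exact: noise_expect_ge0.
- exact: measurable_noise_expect_cons.
- exact: measurable_noise_expect_cons.
move=> z _; apply: IH => //; try exact: seq_measurable_cons.
by move=> l ln; apply: FG; rewrite /= ln.
Qed.

Lemma eq_noise_expect s n F G : (forall l, size l = n -> F l = G l) ->
  noise_expect s n F = noise_expect s n G.
Proof.
elim: n F G => [|n IH] F G FG; first exact: FG.
rewrite !noise_expectS; apply: eq_integral => z _; apply: IH => l ln.
by apply: FG; rewrite /= ln.
Qed.

Lemma noise_expect_sum s n (I : Type) (r : seq I) (F : I -> seq R -> \bar R) :
  (forall i l, 0 <= F i l)%E -> (forall i, seq_measurable (F i)) ->
  (noise_expect s n (fun l => \sum_(i <- r) F i l) = \sum_(i <- r) noise_expect s n (F i))%E.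
Proof.
move=> F0 mF; elim: r => [|i r IH].
  rewrite big_nil -[RHS](noise_expect_cst s n); apply: eq_noise_expect => l _.
  by rewrite big_nil.
rewrite big_cons -IH -noise_expectD//.
- by apply: eq_noise_expect => l _; rewrite big_cons.
- by move=> l; apply: sume_ge0.
- move=> m; apply: emeasurable_sum => j; exact: mF.
Qed.

Section Rcons.
Context d (X : measurableType d).

Lemma measurable_rcons n (f : X -> n.-tuple R) (g : X -> R) :
  measurable_fun [set: X] f -> measurable_fun [set: X] g ->
  measurable_fun [set: X] (fun x => [the n.+1.-tuple R of rcons (f x) (g x)]).
Proof.
move=> mf mg; apply/measurable_fun_tnthP => i.
have [i_n|i_n] := ltnP i n.
  rewrite [X in measurable_fun _ X](_ : _ = fun x => tnth (f x) (Ordinal i_n)).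
    exact: (measurableT_comp (measurable_tnth _) mf).
  by apply/funext => x /=; rewrite !(tnth_nth 0)/= nth_rcons size_tuple i_n.
rewrite [X in measurable_fun _ X](_ : _ = g)//.
have iE : i = n :> nat by apply/eqP; rewrite eqn_leq i_n -ltnS ltn_ord.
by apply/funext => x /=; rewrite (tnth_nth 0)/= nth_rcons size_tuple iE ltnn eqxx.
Qed.

Lemma measurable_fun_rcons n (F : n.+1.-tuple R -> X) :
  measurable_fun [set: n.-tuple R * R] (fun p => F [the n.+1.-tuple R of rcons p.1 p.2]) ->
  measurable_fun [set: n.+1.-tuple R] F.
Proof.
move=> mF.
pose bl (t : n.+1.-tuple R) : n.-tuple R := [tuple tnth t (widen_ord (leqnSn n) i) | i < n].
pose h t : n.-tuple R * R := (bl t, tnth t ord_max).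
have hE (t : n.+1.-tuple R) : t = [the n.+1.-tuple R of rcons (bl t) (tnth t ord_max)].
  apply/val_inj/(@eq_from_nth _ 0); first by rewrite size_rcons !size_tuple.
  move=> i; rewrite size_tuple ltnS leq_eqVlt => /orP[/eqP->|i_n].
    by rewrite nth_rcons size_tuple ltnn eqxx (tnth_nth 0).
  rewrite nth_rcons size_tuple i_n -[i]/(val (Ordinal i_n)) -tnth_nth tnth_mktuple.
  by rewrite (tnth_nth 0).
rewrite [X in measurable_fun _ X](_ : _ =
  (fun p : n.-tuple R * R => F [the n.+1.-tuple R of rcons p.1 p.2]) \o h); last first.
  by apply/funext => t /=; rewrite [in LHS](hE t).
apply: measurableT_comp; first exact: mF.
apply/measurable_fun_pair; last exact: measurable_tnth.
apply/measurable_fun_tnthP => i.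
rewrite [X in measurable_fun _ X](_ : _ = fun t => tnth t (widen_ord (leqnSn n) i)).
  exact: measurable_tnth.
by apply/funext => t /=; rewrite tnth_mktuple.
Qed.

(** Causal quantities grow at the right end of the history, whereas [noise_expect] peels samples off
    the left; this induction principle handles the former. *)
Lemma seq_measurable_rcons (F : seq R -> X) :
  (forall n, measurable_fun [set: n.-tuple R] (fun t => F (tval t)) ->
    measurable_fun [set: n.-tuple R * R] (fun p => F (rcons (tval p.1) p.2))) ->
  seq_measurable F.
Proof.
move=> IH; elim => [|n mF]; last by apply: measurable_fun_rcons; exact: IH.
rewrite [X in measurable_fun _ X](_ : _ = cst (F [::]))//.
by apply/funext => t; rewrite tuple0.
Qed.

End Rcons.
End Noise.

(** * Change of measure along a feedback policy *)

Section Policy.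
Context {R : realType}.
Implicit Types (s : R) (x m : seq R -> R) (k : seq R -> R -> R) (l : seq R).

(** The outputs of the policy [x] under the noise [l]. Recursing on the first sample matches
    [noise_expect], at the cost of shifting the policy; [run_rcons] gives back the causal form used
    by [outputs]. *)
Fixpoint run x l : seq R :=
  if l is z :: l' then let y := x [::] + z in y :: run (fun h => x (y :: h)) l'
  else [::].

(** The summand [k h z] sees the past outputs [h] and the fresh noise [z], hence both energies and
    log-likelihoods are instances. *)
Fixpoint run_sum x k l : R :=
  if l is z :: l' then
    let y := x [::] + z in
    k [::] z + run_sum (fun h => x (y :: h)) (fun h => k (y :: h)) l'
  else 0.

Lemma size_run x l : size (run x l) = size l.
Proof. by elim: l x => //= z l IH x; rewrite IH. Qed.

Lemma run_rcons x l z : run x (rcons l z) = rcons (run x l) (x (run x l) + z).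
Proof. by elim: l x => //= y l IH x; rewrite IH. Qed.

Lemma run_sum_rcons x k l z :
  run_sum x k (rcons l z) = run_sum x k l + k (run x l) z.
Proof.
by elim: l x k => [|y l IH] x k /=; rewrite ?add0r ?addr0// IH addrA.
Qed.

Lemma run_sumE x k l :
  run_sum x k l = \sum_(i < size l) k (run x (take i l)) (nth 0 l i).
Proof.
elim: l x k => [|z l IH] x k /=; first by rewrite big_ord0.
by rewrite big_ord_recl /= IH.
Qed.

Lemma run_sumD x k k' l :
  run_sum x (fun h z => k h z + k' h z) l = run_sum x k l + run_sum x k' l.
Proof. by rewrite !run_sumE big_split. Qed.

Lemma run_sum_ge0 x k l : (forall h z, 0 <= k h z) -> 0 <= run_sum x k l.
Proof. by move=> k0; rewrite run_sumE sumr_ge0. Qed.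

Lemma run_tupleP x n (t : n.-tuple R) : size (run x t) == n.
Proof. by rewrite size_run size_tuple. Qed.

Definition run_tuple x n (t : n.-tuple R) := Tuple (run_tupleP x t).

Definition step_measurable k :=
  forall n, measurable_fun [set: n.-tuple R * R] (fun p => k (tval p.1) p.2).

Lemma step_measurable_fst x : seq_measurable x -> step_measurable (fun h _ => x h).
Proof. by move=> mx n; exact: (measurableT_comp (mx n) measurable_fst). Qed.

Lemma measurable_run x n : seq_measurable x -> measurable_fun [set: n.-tuple R] (@run_tuple x n).
Proof.
move=> mx; elim: n => [|n IH].
  rewrite [X in measurable_fun _ X](_ : _ = cst [tuple])//.
  by apply/funext => t; rewrite [LHS]tuple0.
apply: measurable_fun_rcons.
pose f (p : n.-tuple R * R) := run_tuple x p.1.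
have mf : measurable_fun [set: n.-tuple R * R] f.
  exact: (measurableT_comp IH measurable_fst).
have mg : measurable_fun [set: n.-tuple R * R] (fun p => x (f p) + p.2).
  by apply: measurable_funD => //; exact: (measurableT_comp (mx n) mf).
rewrite [X in measurable_fun _ X](_ : _ =
  fun p : n.-tuple R * R => [the n.+1.-tuple R of rcons (f p) (x (f p) + p.2)]).
  exact: measurable_rcons mf mg.
by apply/funext => p; apply: val_inj; rewrite /= run_rcons.
Qed.

Lemma seq_measurable_run d (T : measurableType d) (F : seq R -> T) x :
  seq_measurable F -> seq_measurable x -> seq_measurable (fun l => F (run x l)).
Proof.
move=> mF mx n; apply: (measurableT_comp (mF n) (_ : measurable_fun _ (@run_tuple x n))).
exact: measurable_run.
Qed.

Lemma step_measurable_run k x : seq_measurable x -> step_measurable k ->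
  step_measurable (fun h z => k (run x h) z).
Proof.
move=> mx mk n; pose h (p : n.-tuple R * R) := (run_tuple x p.1, p.2).
apply: (measurableT_comp (mk n) (_ : measurable_fun _ h)).
have mr := @measurable_run x n mx.
apply/measurable_fun_pair; last exact: measurable_snd.
exact: (measurableT_comp mr measurable_fst).
Qed.

Lemma seq_measurable_run_sum x k : seq_measurable x -> step_measurable k ->
  seq_measurable (run_sum x k).
Proof.
move=> mx mk; apply: seq_measurable_rcons => n mS.
under eq_fun do rewrite run_sum_rcons.
apply: measurable_funD; first exact: (measurableT_comp mS measurable_fst).
exact: step_measurable_run.
Qed.

(** Logarithm of the density of the output [x h + z] under the reference law with mean [m h] and
    deviation [s'], over its density under the true law. *)
Definition log_ratio s s' x m (h : seq R) (z : R) : R :=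
  ln (s / s') - (x h + z - m h) ^+ 2 / (2 * s' ^+ 2) + z ^+ 2 / (2 * s ^+ 2).

Definition likelihood s s' x m l := expR (run_sum x (log_ratio s s' x m) l).

Lemma step_measurable_sqr x : seq_measurable x -> step_measurable (fun h z => (x h + z) ^+ 2).
Proof.
move=> mx n; apply: measurable_funX; apply: measurable_funD => //.
exact: step_measurable_fst.
Qed.

Lemma seq_measurableB x m : seq_measurable x -> seq_measurable m ->
  seq_measurable (fun h => x h - m h).
Proof. by move=> mx mm n; apply: measurable_funB; [exact: mx|exact: mm]. Qed.

Lemma seq_measurable_likelihood s s' x m : seq_measurable x -> seq_measurable m ->
  seq_measurable (fun l => (likelihood s s' x m l)%:E).
Proof.
move=> mx mm n; apply/measurable_EFinP; apply: measurableT_comp => //.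
apply: seq_measurable_run_sum => // {}n; rewrite /log_ratio.
apply: measurable_funD; last by apply: measurable_funM => //; exact: measurable_funX.
apply: measurable_funB => //; apply: measurable_funM => //.
have -> : (fun p : n.-tuple R * R => (x p.1 + p.2 - m p.1) ^+ 2) =
    (fun p => (x p.1 - m p.1 + p.2) ^+ 2).
  by apply/funext => p; rewrite addrAC.
by apply: (step_measurable_sqr (x := fun h => x h - m h)); exact: seq_measurableB.
Qed.

(** By induction: [normal_change_of_measure] treats the first output [y], and the induction
    hypothesis applies to both policies shifted by that same [y], although it arises from different
    noise samples under the two laws. *)
Lemma noise_expect_likelihood s s' n x m (H : seq R -> \bar R) : 0 < s -> 0 < s' ->
  seq_measurable x -> seq_measurable m -> seq_measurable H -> (forall l, 0 <= H l)%E ->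
  noise_expect s n (fun l => (likelihood s s' x m l)%:E * H (run x l))%E =
  noise_expect s' n (fun l => H (run m l)).
Proof.
move=> s0 s'0; elim: n x m H => [|n IH] x m H mx mm mH H0.
  by rewrite /noise_expect /= /likelihood /= expR0 mul1e.
rewrite !noise_expectS /=.
pose f y := noise_expect s' n (fun l => H (y :: run (fun h => m (y :: h)) l)).
pose g z := noise_expect s' n (fun l => H (run m (z :: l))).
have mg : measurable_fun [set: R] g.
  apply: (@measurable_noise_expect_cons _ s' n (fun l => H (run m l))) => //.
  exact: seq_measurable_run.
have mf : measurable_fun [set: R] f.
  (* [g] leaves the first noise sample free, so its measurability is already known; [f] is [g]
     expressed in the output instead of the noise. *)
  have -> : f = g \o (fun y => y - m [::]).
    by apply/funext => y; rewrite /f /g /= addrC subrK.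
  by apply: measurableT_comp => //; exact: measurable_funB.
have f0 y : (0 <= f y)%E by exact: noise_expect_ge0.
have s_neq0 : s != 0 by rewrite gt_eqF.
rewrite -(normal_change_of_measure s' (x [::]) (m [::]) s_neq0 mf f0).
apply: eq_integral => z _; rewrite normal_ratioE//.
set y := x [::] + z.
rewrite -[f y](IH (fun h => x (y :: h)) (fun h => m (y :: h)) (fun l => H (y :: l)));
  do ?exact: seq_measurable_cons.
- rewrite -noise_expectZ ?expR_ge0//.
  + apply: eq_noise_expect => l _; rewrite muleA -EFinM /likelihood /= -/y.
    by rewrite expRD.
  + by move=> l; rewrite mule_ge0// lee_fin expR_ge0.
  + move=> p; apply: emeasurable_funM.
      by apply: seq_measurable_likelihood; exact: seq_measurable_cons.
    apply: (@seq_measurable_run _ _ (fun l => H (y :: l))); exact: seq_measurable_cons.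
- by [].
Qed.

(** The fresh noise is independent of the past outputs, so each summand can be averaged over its own
    sample with the history frozen. Every step contributes the same constant [c], which will be the
    noise variance. *)
Lemma noise_expect_run_sum s n x k (k' : seq R -> R) (c : R) : 0 < s -> 0 <= c ->
  seq_measurable x -> step_measurable k -> seq_measurable k' ->
  (forall h z, 0 <= k h z) -> (forall h, 0 <= k' h) ->
  (forall h, \int[normal_prob 0 s]_z (k h z)%:E = (k' h + c)%:E)%E ->
  (noise_expect s n (fun l => (run_sum x k l)%:E) =
   noise_expect s n (fun l => (run_sum x (fun h _ => k' h) l)%:E) + (n%:R * c)%:E)%E.
Proof.
move=> s0 c0; elim: n x k k' => [|n IH] x k k' mx mk mk' k0 k'0 kE.
  by rewrite /noise_expect /= mul0r adde0.
have split_head q (qm : step_measurable q) (q0 : forall h z, 0 <= q h z) :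
    (noise_expect s n.+1 (fun l => (run_sum x q l)%:E) =
     \int[normal_prob 0 s]_z (q [::] z)%:E +
     \int[normal_prob 0 s]_z noise_expect s n (fun l =>
       (run_sum (fun h => x (x [::] + z :: h)) (fun h => q (x [::] + z :: h)) l)%:E))%E.
  have mq : measurable_fun [set: R] (q [::]).
    exact: (measurableT_comp (qm 0%N) (measurable_pair1 [tuple])).
  have mS : seq_measurable (run_sum x q) by exact: seq_measurable_run_sum.
  rewrite -ge0_integralD//; first last.
  - apply: measurable_noise_expect => [z l|]; first by rewrite lee_fin run_sum_ge0.
    apply/measurable_EFinP.
    (* Writing the tail as the whole sum minus its head reduces joint measurability in the first
       sample and the rest to that of [run_sum] on [n.+1] samples. *)
    have -> : (fun p : R * n.-tuple R => run_sum (fun h => x (x [::] + p.1 :: h))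
        (fun h => q (x [::] + p.1 :: h)) p.2) =
        (fun p => run_sum x q (p.1 :: p.2) - q [::] p.1).
      by apply/funext => p /=; rewrite [in RHS]addrC addKr.
    apply: measurable_funB; last exact: (measurableT_comp mq measurable_fst).
    pose h (p : R * n.-tuple R) := [the n.+1.-tuple R of p.1 :: p.2].
    by apply: (measurableT_comp (mS n.+1) (_ : measurable_fun _ h)); exact: measurable_cons.
  - by move=> z _; apply: noise_expect_ge0 => l; rewrite lee_fin run_sum_ge0.
  - exact/measurable_EFinP.
  - by move=> z _; rewrite lee_fin.
  rewrite noise_expectS; apply: eq_integral => z _ /=.
  rewrite -[X in (X + _)%E](noise_expect_cst s n) -noise_expectD.
  - by apply: eq_noise_expect => l _.
  - by move=> _; rewrite lee_fin.
  - by move=> l; rewrite lee_fin run_sum_ge0.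
  - by move=> p; exact: measurable_cst.
  - move=> p; apply/measurable_EFinP.
    have -> : (fun t : p.-tuple R => run_sum (fun h => x (x [::] + z :: h))
        (fun h => q (x [::] + z :: h)) t) =
        (fun t => run_sum x q (z :: t) - q [::] z).
      by apply/funext => t /=; rewrite [in RHS]addrC addKr.
    by apply: measurable_funB => //; exact: (seq_measurable_cons _ mS).
rewrite split_head// split_head//; last exact: step_measurable_fst.
rewrite kE integral_normal_cst.
set J := (X in (_ = _ + X + _)%E).
have mtail (y : R) : step_measurable (fun h => k (y :: h)).
  move=> p; pose h (q : p.-tuple R * R) := ([the p.+1.-tuple R of y :: q.1], q.2).
  apply: (measurableT_comp (mk p.+1) (_ : measurable_fun _ h)).
  by apply/measurable_fun_pair => //; exact: measurable_cons.
transitivity ((k' [::] + c)%:E + \int[normal_prob 0 s]_z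
    (noise_expect s n (fun l => (run_sum (fun h => x ((x [::] + z)%R :: h))
      (fun h _ => k' ((x [::] + z)%R :: h)) l)%:E) + (n%:R * c)%:E))%E.
  congr (_ + _)%E; apply: eq_integral => z _.
  by apply: IH => //; exact: seq_measurable_cons.
rewrite ge0_integralD//.
- rewrite integral_normal_cst -/J EFinD addeACA -EFinD; congr (_ + _%:E)%E.
  by rewrite -natr1 mulrDl mul1r addrC.
- by move=> z _; apply: noise_expect_ge0 => l; rewrite lee_fin run_sum_ge0.
- apply: measurable_noise_expect => [z l|]; first by rewrite lee_fin run_sum_ge0.
  apply/measurable_EFinP.
  have -> : (fun p : R * n.-tuple R => run_sum (fun h => x (x [::] + p.1 :: h))
      (fun h _ => k' (x [::] + p.1 :: h)) p.2) =
      (fun p => run_sum x (fun h _ => k' h) (p.1 :: p.2) - k' [::]).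
    by apply/funext => p /=; rewrite [in RHS]addrC addKr.
  apply: measurable_funB => //.
  pose h (p : R * n.-tuple R) := [the n.+1.-tuple R of p.1 :: p.2].
  have mS : seq_measurable (run_sum x (fun h _ => k' h)).
    by apply: seq_measurable_run_sum => //; exact: step_measurable_fst.
  by apply: (measurableT_comp (mS n.+1) (_ : measurable_fun _ h)); exact: measurable_cons.
- by move=> z _; rewrite lee_fin mulr_ge0.
Qed.

End Policy.

Section RealExpectation.
Context {R : realType}.
Implicit Types (s : R) (f g : seq R -> R).

Lemma noise_expect_EFinD s n f g : (forall l, 0 <= f l) -> (forall l, 0 <= g l) ->
  seq_measurable f -> seq_measurable g ->
  (noise_expect s n (fun l => (f l + g l)%:E) =
   noise_expect s n (fun l => (f l)%:E) + noise_expect s n (fun l => (g l)%:E))%E.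
Proof.
move=> f0 g0 mf mg; rewrite -noise_expectD//.
- by move=> p; apply/measurable_EFinP; exact: mf.
- by move=> p; apply/measurable_EFinP; exact: mg.
Qed.

Lemma noise_expect_EFinZ s n (k : R) f : 0 <= k -> (forall l, 0 <= f l) -> seq_measurable f ->
  (noise_expect s n (fun l => (k * f l)%:E) = k%:E * noise_expect s n (fun l => (f l)%:E))%E.
Proof.
move=> k0 f0 mf; rewrite -noise_expectZ//.
- by move=> p; apply/measurable_EFinP; exact: mf.
Qed.

Lemma noise_expect_EFin_cstD s n (k : R) f : 0 <= k -> (forall l, 0 <= f l) ->
  seq_measurable f ->
  (noise_expect s n (fun l => (k + f l)%:E) = k%:E + noise_expect s n (fun l => (f l)%:E))%E.
Proof.
by move=> k0 f0 mf; rewrite noise_expect_EFinD// noise_expect_cst.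
Qed.

Lemma noise_expect_EFin_le s n f g : (forall l, 0 <= f l) ->
  (forall l, 0 <= g l) -> (forall l, size l = n -> f l <= g l) ->
  seq_measurable f -> seq_measurable g ->
  (noise_expect s n (fun l => (f l)%:E) <= noise_expect s n (fun l => (g l)%:E))%E.
Proof.
move=> f0 g0 fg mf mg; apply: noise_expect_le => //.
- by move=> p; apply/measurable_EFinP; exact: mf.
- by move=> p; apply/measurable_EFinP; exact: mg.
Qed.

End RealExpectation.

(** * Bounds on the probability of correct decoding *)

Section Converse.
Context {R : realType}.
Implicit Types (s : R) (x m : seq R -> R) (l : seq R).

Lemma run_sum_log_ratio s s' x m l : run_sum x (log_ratio s s' x m) l =
  (size l)%:R * ln (s / s') - run_sum x (fun h z => (x h - m h + z) ^+ 2) l / (2 * s' ^+ 2) +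
  run_sum x (fun _ z => z ^+ 2) l / (2 * s ^+ 2).
Proof.
rewrite !run_sumE !mulr_suml.
have -> : (size l)%:R * ln (s / s') = \sum_(i < size l) ln (s / s').
  by rewrite sumr_const card_ord mulr_natl.
rewrite -sumrB -big_split /=; apply: eq_bigr => i _.
by congr (_ - _ ^+ 2 / _ + _); exact: addrAC.
Qed.

(* With [g = (ln M) * 1_C], [L] the likelihood, this integrates
   [1 + (g + ln L) <= expR g * L]; all terms are arranged to be nonnegative. *)
Lemma noise_expect_correct s s' n x m (C : seq R -> bool) (M : R) : 0 < s -> s <= s' -> 1 <= M ->
  seq_measurable x -> seq_measurable m -> seq_measurable (fun l => (C l)%:R : R) ->
  ((ln M)%:E * noise_expect s n (fun l => ((C (run x l))%:R)%:E) + (n%:R / 2 + 1)%:E <=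
   noise_expect s' n (fun l => (1 + (M - 1) * (C (run m l))%:R)%:E) +
   ((n%:R * ln (s' / s) + n%:R * s ^+ 2 / (2 * s' ^+ 2))%:E +
   ((2 * s' ^+ 2)^-1)%:E *
   noise_expect s n (fun l => (run_sum x (fun h _ => (x h - m h) ^+ 2) l)%:E)))%E.
Proof.
move=> s0 ss' M1 mx mm mC; have s'0 : 0 < s' by exact: lt_le_trans ss'.
have s20 : 0 < 2 * s ^+ 2 by rewrite mulr_gt0// exprn_gt0.
have s'20 : 0 < 2 * s' ^+ 2 by rewrite mulr_gt0// exprn_gt0.
have lnM : 0 <= ln M by exact: ln_ge0.
have lns : 0 <= ln (s' / s) by rewrite ln_ge0// ler_pdivlMr// mul1r.
pose Z l := run_sum x (fun _ z => z ^+ 2) l.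
pose A l := run_sum x (fun h z => (x h - m h + z) ^+ 2) l.
pose H (y : seq R) : R := 1 + (M - 1) * (C y)%:R.
have Z0 l : 0 <= Z l by apply: run_sum_ge0 => h z; exact: sqr_ge0.
have A0 l : 0 <= A l by apply: run_sum_ge0 => h z; exact: sqr_ge0.
have H0 y : 0 <= H y by rewrite addr_ge0// mulr_ge0// subr_ge0.
have C0 y : 0 <= (C y)%:R :> R by [].
have mZ : seq_measurable Z.
  apply: seq_measurable_run_sum => // p; apply: measurable_funX.
  exact: measurable_snd.
have mA : seq_measurable A.
  apply: seq_measurable_run_sum => //.
  by apply: (@step_measurable_sqr _ (fun h => x h - m h)); exact: seq_measurableB.
have mH : seq_measurable H.
  by move=> p; apply: measurable_funD => //; apply: measurable_funM => //; exact: mC.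
have mCx : seq_measurable (fun l => (C (run x l))%:R : R).
  by apply: (@seq_measurable_run _ _ R (fun l => (C l)%:R : R)).
have EZ : noise_expect s n (fun l => (Z l)%:E) = (n%:R * s ^+ 2)%:E.
  rewrite (@noise_expect_run_sum _ s n x (fun _ z => z ^+ 2) (fun=> 0) (s ^+ 2))//.
  - rewrite (_ : (fun l => _) = fun=> 0%E) ?noise_expect_cst ?add0e//.
    by apply/funext => l; rewrite run_sumE big1.
  - exact: sqr_ge0.
  - by move=> p; apply: measurable_funX; exact: measurable_snd.
  - by move=> h z; exact: sqr_ge0.
  - by move=> h; rewrite normal_second_moment// add0r.
have EA : noise_expect s n (fun l => (A l)%:E) =
    (noise_expect s n (fun l => (run_sum x (fun h _ => (x h - m h) ^+ 2) l)%:E) +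
     (n%:R * s ^+ 2)%:E)%E.
  apply: noise_expect_run_sum => //.
  - exact: sqr_ge0.
  - by apply: (@step_measurable_sqr _ (fun h => x h - m h)); exact: seq_measurableB.
  - by move=> p; apply: measurable_funX; exact: seq_measurableB.
  - by move=> h z; exact: sqr_ge0.
  - by move=> h; exact: sqr_ge0.
  - by move=> h; exact: normal_second_moment_shift.
have EL : noise_expect s n (fun l => (likelihood s s' x m l * H (run x l))%:E) =
    noise_expect s' n (fun l => (H (run m l))%:E).
  rewrite -(@noise_expect_likelihood _ s s' n x m (fun y => (H y)%:E))//.
  by move=> p; apply/measurable_EFinP; exact: mH.
set EB := noise_expect s n (fun l => (run_sum x _ l)%:E) in EA *.
have EB0 : (0 <= EB)%E.
  by apply: noise_expect_ge0 => l; rewrite lee_fin run_sum_ge0// => h _; exact: sqr_ge0.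
have mL : seq_measurable (fun l => likelihood s s' x m l * H (run x l)).
  move=> p; apply: measurable_funM; last exact: seq_measurable_run.
  by apply/measurable_EFinP; exact: seq_measurable_likelihood.
have L0 l : 0 <= likelihood s s' x m l * H (run x l) by rewrite mulr_ge0// expR_ge0.
have pointwise l : size l = n ->
    ln M * (C (run x l))%:R + (1 + (2 * s ^+ 2)^-1 * Z l) <=
    likelihood s s' x m l * H (run x l) + (n%:R * ln (s' / s) + (2 * s' ^+ 2)^-1 * A l).
  move=> ln_; pose g := ln M * (C (run x l))%:R.
  have expg : H (run x l) = expR g.
    rewrite /H /g; case: (C _); rewrite ?mulr0 ?mulr1 ?expR0 ?addr0//.
    by rewrite lnK ?posrE ?(lt_le_trans _ M1)// addrC subrK.
  rewrite expg /likelihood -expRD.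
  have := expR_ge1Dx (run_sum x (log_ratio s s' x m) l + g).
  rewrite {1}run_sum_log_ratio ln_ -/(A l) -/(Z l).
  have -> : ln (s / s') = - ln (s' / s) by rewrite -lnV ?posrE ?divr_gt0// invf_div.
  rewrite -/g; move: (expR _) => E; rewrite ![_^-1 * _]mulrC; lra.
have mulE (k : R) (f : seq R -> R) : 0 <= k -> (forall l, 0 <= f l) -> seq_measurable f ->
    seq_measurable (fun l => k * f l) /\ (forall l, 0 <= k * f l).
  move=> k0 f0 mf; split => [p|l]; last by rewrite mulr_ge0.
  by apply: measurable_funM => //; exact: mf.
have addE (f g : seq R -> R) : seq_measurable f -> seq_measurable g ->
    (forall l, 0 <= f l) -> (forall l, 0 <= g l) ->
    seq_measurable (fun l => f l + g l) /\ (forall l, 0 <= f l + g l).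
  move=> mf mg f0 g0; split => [p|l]; last by rewrite addr_ge0.
  by apply: measurable_funD; [exact: mf|exact: mg].
have [m1 p1] := mulE (ln M) _ lnM (fun l => C0 (run x l)) mCx.
have iv2 : 0 <= (2 * s ^+ 2)^-1 by rewrite invr_ge0 ltW.
have iv'2 : 0 <= (2 * s' ^+ 2)^-1 by rewrite invr_ge0 ltW.
have [m2 p2] := mulE _ _ iv2 Z0 mZ.
have [m3 p3] := mulE _ _ iv'2 A0 mA.
have mcst (c : R) : seq_measurable (fun _ : seq R => c) by move=> p; exact: measurable_cst.
have [m4 p4] := addE _ _ (mcst 1) m2 (fun=> ler01) p2.
have nln : 0 <= n%:R * ln (s' / s) by rewrite mulr_ge0.
have [m5 p5] := addE _ _ (mcst (n%:R * ln (s' / s))) m3 (fun=> nln) p3.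
have [m6 p6] := addE _ _ m1 m4 p1 p4.
have [m7 p7] := addE _ _ mL m5 L0 p5.
have := noise_expect_EFin_le s p6 p7 pointwise m6 m7.
rewrite (noise_expect_EFinD s n p1 p4 m1 m4) (noise_expect_EFin_cstD s n ler01 p2 m2).
rewrite (noise_expect_EFinZ s n lnM (fun l => C0 (run x l)) mCx).
rewrite (noise_expect_EFinZ s n iv2 Z0 mZ) EZ.
rewrite (noise_expect_EFinD s n L0 p5 mL m5) EL (noise_expect_EFin_cstD s n nln p3 m3).
rewrite (noise_expect_EFinZ s n iv'2 A0 mA) EA.
rewrite ge0_muleDr//; last by rewrite lee_fin mulr_ge0// sqr_ge0.
rewrite -!EFinM -EFinD.
(* The noise energy has mean [n s^2] whatever the policy; this is the origin of the constant
   [n%:R / 2 + 1]. *)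
have -> : 1 + (2 * s ^+ 2)^-1 * (n%:R * s ^+ 2) = n%:R / 2 + 1.
  by field; rewrite gt_eqF.
move=> /le_trans; apply; apply: leeD => //.
rewrite [X in (_ + X)%E]addeC addeA -EFinD; apply: leeD => //.
by rewrite lee_fin [_^-1 * _]mulrC.
Qed.

(** The reference policy [m] is common to all messages [i], so under the reference law the output
    carries no information on [i]; a receiver that announces at most one message then succeeds for
    at most one [i] per output sequence. *)
Lemma noise_expect_sum_correct (I : finType) s s' n (x : I -> seq R -> R) m (C : I -> seq R -> bool) :
  0 < s -> s <= s' -> (0 < #|I|)%N ->
  (forall i, seq_measurable (x i)) -> seq_measurable m ->
  (forall i, seq_measurable (fun l => (C i l)%:R : R)) ->
  (forall l, size l = n -> \sum_i (C i l)%:R <= 1 :> R) ->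
  ((ln #|I|%:R)%:E * (\sum_i noise_expect s n (fun l => ((C i (run (x i) l))%:R)%:E)) +
     (#|I|%:R * (n%:R / 2 + 1))%:E <=
   (#|I|%:R * (2 + n%:R * ln (s' / s) + n%:R * s ^+ 2 / (2 * s' ^+ 2)))%:E +
   ((2 * s' ^+ 2)^-1)%:E *
   \sum_i noise_expect s n (fun l => (run_sum (x i) (fun h _ => (x i h - m h) ^+ 2) l)%:E))%E.
Proof.
move=> s0 ss' I0 mx mm mC C1; have s'0 : 0 < s' by exact: lt_le_trans ss'.
have M1 : 1 <= #|I|%:R :> R by rewrite ler1n.
have M0 : 0 <= #|I|%:R - 1 :> R by rewrite subr_ge0.
have iv'2 : 0 <= (2 * s' ^+ 2)^-1 by rewrite invr_ge0 mulr_ge0// sqr_ge0.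
have sum_cst (c : R) : (\sum_(i : I) c%:E)%E = (#|I|%:R * c)%:E.
  by rewrite sumEFin sumr_const mulr_natl.
have := lee_sum (index_enum I) (fun i (_ : true) =>
  noise_expect_correct n s0 ss' M1 (mx i) mm (mC i)).
rewrite !big_split /= !sum_cst -!ge0_sume_distrr; first last.
- by move=> i _; apply: noise_expect_ge0 => l; rewrite lee_fin.
- move=> i _; apply: noise_expect_ge0 => l.
  by rewrite lee_fin run_sum_ge0// => h _; exact: sqr_ge0.
move=> /le_trans; apply.
rewrite addeA; apply: leeD => //.
rewrite -[2 + _ + _]addrA [X in (_ <= X%:E)%E]mulrDr [leRHS]EFinD; apply: leeD => //.
rewrite -noise_expect_sum//; first last.
- move=> i p; apply/measurable_EFinP; apply: measurable_funD => //.
  by apply: measurable_funM => //; exact: (@seq_measurable_run _ _ R (fun l => (C i l)%:R : R)).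
- by move=> i l; rewrite lee_fin addr_ge0// mulr_ge0.
rewrite -[leRHS](noise_expect_cst s' n); apply: noise_expect_le => //.
- by move=> l; apply: sume_ge0 => i _; rewrite lee_fin addr_ge0// mulr_ge0.
- move=> l ln_; rewrite sumEFin lee_fin big_split /= sumr_const -mulr_sumr.
  have := C1 (run m l); rewrite size_run => /(_ ln_) Cl.
  (* The reference side sums to at most [#|I| + (#|I| - 1)], whence the constant [2] per message. *)
  apply: le_trans (_ : #|I|%:R + (#|I|%:R - 1) * 1 <= _); first by rewrite lerD2l ler_wpM2l.
  lra.
- move=> p; apply: emeasurable_sum => i; apply/measurable_EFinP.
  apply: measurable_funD => //; apply: measurable_funM => //.
  exact: (@seq_measurable_run _ _ R (fun l => (C i l)%:R : R)).
Qed.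

End Converse.

(** * The converse for a single code *)

Section Codes.
Context {R : realType}.
Implicit Types (s : R) (l h : seq R).

Definition on_history T (f : forall i, i.-tuple R -> T) h := f (size h) (in_tuple h).

Lemma on_historyE T (f : forall i, i.-tuple R -> T) n (t : n.-tuple R) :
  on_history f t = f n t.
Proof.
case: t => t sz; rewrite /on_history /=.
suff: forall k (e : size t = k) (tk : size t == k), f (size t) (in_tuple t) = f k (Tuple tk).
  by apply; exact/eqP.
by move=> k <- tk; congr f; exact: val_inj.
Qed.

Lemma seq_measurable_on_history d (T : measurableType d) (f : forall i, i.-tuple R -> T) :
  (forall i, measurable_fun [set: i.-tuple R] (f i)) -> seq_measurable (on_history f).
Proof. by move=> mf n; under eq_fun do rewrite on_historyE; exact: mf. Qed.

Lemma seq_measurable_take d (T : measurableType d) (F : seq R -> T) i :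
  seq_measurable F -> seq_measurable (fun l => F (take i l)).
Proof.
move=> mF n; pose g (t : n.-tuple R) := [tuple of take i t].
apply: (measurableT_comp (mF (minn i n)) (_ : measurable_fun _ g)).
apply/measurable_fun_tnthP => j.
have jn : (j < n)%N by rewrite (leq_trans (ltn_ord j)) ?geq_minr.
rewrite [X in measurable_fun _ X](_ : _ = fun t => tnth t (Ordinal jn)).
  exact: measurable_tnth.
apply/funext => t /=; rewrite !(tnth_nth 0) /= nth_take//.
by rewrite (leq_trans (ltn_ord j)) ?geq_minl.
Qed.

Lemma gauss_expectE s n (F : n.-tuple R -> \bar R) (G : seq R -> \bar R) :
  (forall t : n.-tuple R, F t = G t) -> gauss_expect s F = noise_expect s n G.
Proof. by move=> FG; congr gauss_expect; apply/funext. Qed.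

Context (N M1 M2 : nat) (c : @fb_code R N M1 M2).

Definition signal1 w1 := on_history (fun i => @enc1 R N M1 M2 c i w1).
Definition signal2 w1 w2 := on_history (fun i => @enc2 R N M1 M2 c i w1 w2).
Definition signal w1 w2 h := signal1 w1 h + signal2 w1 w2 h.
(* [insubd] sends lists of length other than [N] to a dummy output sequence. *)
Definition decodes w1 w2 l := dec c (insubd [tuple of nseq N 0] l) == (w1, w2).

Lemma outputs_run w1 w2 l n : (n <= size l)%N ->
  outputs c w1 w2 (nth 0 l) n = run (signal w1 w2) (take n l) :> seq R.
Proof.
elim: n => [|n IH] nl; first by rewrite take0.
rewrite (take_nth 0)// run_rcons -IH; last exact: ltnW.
by rewrite /= /signal /signal1 /signal2 !on_historyE.
Qed.

Lemma input1E w1 w2 l i : (i <= size l)%N ->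
  input1 c w1 w2 (nth 0 l) i = signal1 w1 (run (signal w1 w2) (take i l)).
Proof. by move=> il; rewrite -outputs_run// /signal1 on_historyE. Qed.

Lemma input2E w1 w2 l i : (i <= size l)%N ->
  input2 c w1 w2 (nth 0 l) i = signal2 w1 w2 (run (signal w1 w2) (take i l)).
Proof. by move=> il; rewrite -outputs_run// /signal2 on_historyE. Qed.

Lemma decodesE w1 w2 w1' w2' l : size l = N ->
  (dec c (outputs c w1 w2 (nth 0 l) N) == (w1', w2')) =
  decodes w1' w2' (run (signal w1 w2) l).
Proof.
move=> lN; rewrite /decodes -{2}[l]take_size lN -outputs_run ?lN//.
by rewrite valKd.
Qed.

Hypothesis mc : fb_code_measurable c.

Lemma seq_measurable_signal1 w1 : seq_measurable (signal1 w1).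
Proof. by apply: seq_measurable_on_history => i; case: mc. Qed.

Lemma seq_measurable_signal2 w1 w2 : seq_measurable (signal2 w1 w2).
Proof. by apply: seq_measurable_on_history => i; case: mc => _ []. Qed.

Lemma seq_measurable_signal w1 w2 : seq_measurable (signal w1 w2).
Proof.
move=> n; apply: measurable_funD.
  exact: seq_measurable_signal1.
exact: seq_measurable_signal2.
Qed.

Lemma seq_measurable_decodes w1 w2 : seq_measurable (fun l => (decodes w1 w2 l)%:R : R).
Proof.
move=> n; have [->|nN] := eqVneq n N.
  rewrite [X in measurable_fun _ X](_ : _ = \1_(dec c @^-1` [set (w1, w2)])); last first.
    apply/funext => t; rewrite indicE /decodes valKd; congr (nat_of_bool _)%:R.
    by apply/eqP/idP => [H|/set_mem]; [rewrite inE|].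
  by apply: measurable_indic; case: mc => _ [].
rewrite [X in measurable_fun _ X](_ : _ = cst (decodes w1 w2 (nseq N 0))%:R)//.
apply/funext => t; congr (nat_of_bool (dec c _ == _))%:R.
rewrite /insubd insubF ?size_tuple; last exact: negbTE.
by rewrite insubT ?size_nseq//= => H; apply: val_inj.
Qed.

(** Summed over messages and time without normalisation: for [q] a squared input this is
    [N * M1 * M2] times its average power. *)
Definition total_energy s (q : 'I_M1 -> 'I_M2 -> seq R -> R) : \bar R :=
  (\sum_w1 \sum_w2 noise_expect s N
    (fun l => (run_sum (signal w1 w2) (fun h _ => q w1 w2 h) l)%:E))%E.

Lemma avg_powerE s (q : 'I_M1 -> 'I_M2 -> seq R -> R)
    (p : 'I_M1 -> 'I_M2 -> (nat -> R) -> nat -> R) :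
  (forall w1 w2 l i, (i <= size l)%N ->
    p w1 w2 (nth 0 l) i = q w1 w2 (run (signal w1 w2) (take i l))) ->
  (forall w1 w2, seq_measurable (q w1 w2)) ->
  (((N%:R)^-1)%:E * (\sum_(i < N) avg_msgs s (fun w1 w2 (z : N.-tuple R) =>
      ((p w1 w2 (noise_fun z) i) ^+ 2)%:E)) =
   (N%:R^-1 * (M1 * M2)%:R^-1)%:E * total_energy s (fun w1 w2 h => q w1 w2 h ^+ 2)%R)%E.
Proof.
move=> pq mq; rewrite EFinM -muleA; congr (_ * _)%E.
rewrite /avg_msgs -ge0_sume_distrr; last first.
  move=> i _; apply: sume_ge0 => w1 _; apply: sume_ge0 => w2 _.
  rewrite (@gauss_expectE s N _ (fun l => (p w1 w2 (nth 0 l) i ^+ 2)%:E))//.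
  by apply: noise_expect_ge0 => l; rewrite lee_fin sqr_ge0.
congr (_ * _)%E; rewrite exchange_big; apply: eq_bigr => w1 _.
rewrite exchange_big; apply: eq_bigr => w2 _ /=.
transitivity (noise_expect s N (fun l => \sum_(i < N)
    (q w1 w2 (run (signal w1 w2) (take i l)) ^+ 2)%R%:E)%E); last first.
  by apply: eq_noise_expect => l lN; rewrite sumEFin run_sumE lN.
rewrite noise_expect_sum; first last.
- move=> i n; apply/measurable_EFinP; apply: measurable_funX.
  apply: (@seq_measurable_take _ _ (fun l => q w1 w2 (run (signal w1 w2) l))).
  by apply: seq_measurable_run => //; exact: seq_measurable_signal.
- by move=> i l; rewrite lee_fin sqr_ge0.
apply: eq_bigr => i _.
rewrite (@gauss_expectE s N _ (fun l => (p w1 w2 (nth 0 l) i ^+ 2)%:E))//.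
by apply: eq_noise_expect => l lN; rewrite pq// lN ltnW.
Qed.

Lemma error_probE s :
  error_prob s c = (((M1 * M2)%:R^-1)%:E * \sum_w1 \sum_w2 noise_expect s N
    (fun l => ((~~ decodes w1 w2 (run (signal w1 w2) l))%:R)%:E))%E.
Proof.
rewrite /error_prob /avg_msgs; congr (_ * _)%E.
apply: eq_bigr => w1 _; apply: eq_bigr => w2 _.
by apply: gauss_expectE => t; rewrite decodesE// size_tuple.
Qed.

Lemma sum_correct_error s :
  (\sum_w1 \sum_w2 noise_expect s N (fun l => ((decodes w1 w2 (run (signal w1 w2) l))%:R)%:E) +
   \sum_w1 \sum_w2 noise_expect s N (fun l => ((~~ decodes w1 w2 (run (signal w1 w2) l))%:R)%:E) =
   (M1 * M2)%:R%:E)%E.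
Proof.
rewrite -big_split /=.
transitivity (\sum_(w1 < M1) \sum_(w2 < M2) 1%E : \bar R)%E.
  apply: eq_bigr => w1 _; rewrite -big_split /=; apply: eq_bigr => w2 _.
  have mD : seq_measurable (fun l => (decodes w1 w2 (run (signal w1 w2) l))%:R : R).
    apply: (@seq_measurable_run _ _ R (fun l => (decodes w1 w2 l)%:R : R)).
      exact: seq_measurable_decodes.
    exact: seq_measurable_signal.
  rewrite -noise_expect_EFinD//.
    rewrite -[RHS](noise_expect_cst s N); apply: eq_noise_expect => l _.
    by case: decodes; rewrite /= ?addr0 ?add0r.
  move=> p; rewrite [X in measurable_fun _ X](_ : _ =
    fun t => 1 - (decodes w1 w2 (run (signal w1 w2) (tval t)))%:R).
    by apply: measurable_funB => //; exact: mD.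
  by apply/funext => t; case: decodes; rewrite ?subrr ?subr0.
under eq_bigr do rewrite sumEFin.
by rewrite sumEFin !sumr_const !card_ord -mulrnA mulnC.
Qed.

End Codes.

Section CodeConverse.
Context {R : realType}.
Context (N M1 M2 : nat) (c : @fb_code R N M1 M2) (mc : fb_code_measurable c).
Implicit Types (s : R) (q : 'I_M1 -> 'I_M2 -> seq R -> R).

Let x1 (w1 : 'I_M1) (w2 : 'I_M2) := signal1 c w1.
Let x2 := signal2 c.

Lemma total_energyD s q q' :
  (forall w1 w2 h, 0 <= q w1 w2 h) -> (forall w1 w2 h, 0 <= q' w1 w2 h) ->
  (forall w1 w2, seq_measurable (q w1 w2)) -> (forall w1 w2, seq_measurable (q' w1 w2)) ->
  total_energy c s (fun w1 w2 h => q w1 w2 h + q' w1 w2 h) =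
  (total_energy c s q + total_energy c s q')%E.
Proof.
move=> q0 q'0 mq mq'; rewrite /total_energy -big_split; apply: eq_bigr => w1 _.
rewrite -big_split; apply: eq_bigr => w2 _ /=.
rewrite -noise_expect_EFinD.
- by apply: eq_noise_expect => l _; rewrite -run_sumD.
- by move=> l; apply: run_sum_ge0.
- by move=> l; apply: run_sum_ge0.
- by apply: seq_measurable_run_sum; [exact: seq_measurable_signal|exact: step_measurable_fst].
- by apply: seq_measurable_run_sum; [exact: seq_measurable_signal|exact: step_measurable_fst].
Qed.

Lemma total_energyZ s k q : 0 <= k ->
  (forall w1 w2 h, 0 <= q w1 w2 h) -> (forall w1 w2, seq_measurable (q w1 w2)) ->
  total_energy c s (fun w1 w2 h => k * q w1 w2 h) = (k%:E * total_energy c s q)%E.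
Proof.
move=> k0 q0 mq.
have ne0 w1 w2 : (0 <= noise_expect s N
    (fun l => (run_sum (signal c w1 w2) (fun h _ => q w1 w2 h) l)%:E))%E.
  by apply: noise_expect_ge0 => l; rewrite lee_fin run_sum_ge0.
rewrite /total_energy ge0_sume_distrr; last by move=> w1 _; exact: sume_ge0.
apply: eq_bigr => w1 _; rewrite ge0_sume_distrr//; apply: eq_bigr => w2 _.
rewrite -noise_expect_EFinZ//.
- by apply: eq_noise_expect => l _; rewrite !run_sumE mulr_sumr.
- by move=> l; apply: run_sum_ge0.
- by apply: seq_measurable_run_sum; [exact: seq_measurable_signal|exact: step_measurable_fst].
Qed.

Lemma total_energy_ge0 s q : (forall w1 w2 h, 0 <= q w1 w2 h) -> (0 <= total_energy c s q)%E.
Proof.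
move=> q0; apply: sume_ge0 => w1 _; apply: sume_ge0 => w2 _.
by apply: noise_expect_ge0 => l; rewrite lee_fin run_sum_ge0.
Qed.

Lemma total_energy_le s q q' : (forall w1 w2 h, 0 <= q w1 w2 h <= q' w1 w2 h) ->
  (forall w1 w2, seq_measurable (q w1 w2)) -> (forall w1 w2, seq_measurable (q' w1 w2)) ->
  (total_energy c s q <= total_energy c s q')%E.
Proof.
move=> x' mq mq'; apply: lee_sum => w1 _; apply: lee_sum => w2 _.
apply: noise_expect_EFin_le.
- by move=> l; apply: run_sum_ge0 => h _; case/andP: (x' w1 w2 h).
- by move=> l; apply: run_sum_ge0 => h _; case/andP: (x' w1 w2 h); exact: le_trans.
- by move=> l _; rewrite !run_sumE; apply: ler_sum => i _; case/andP: (x' w1 w2 (run (signal c w1 w2) (take i l))).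
- by apply: seq_measurable_run_sum; [exact: seq_measurable_signal|exact: step_measurable_fst].
- by apply: seq_measurable_run_sum; [exact: seq_measurable_signal|exact: step_measurable_fst].
Qed.

Lemma eq_total_energy s q q' : (forall w1 w2 h, q w1 w2 h = q' w1 w2 h) ->
  total_energy c s q = total_energy c s q'.
Proof. by move=> x'; congr total_energy; do 3 (apply/funext => ?). Qed.

Definition total_correct s : \bar R :=
  (\sum_w1 \sum_w2 noise_expect s N
    (fun l => ((decodes c w1 w2 (run (signal c w1 w2) l))%:R)%:E))%E.

Lemma total_correct_sum_rate s s' : 0 < s -> s <= s' -> (0 < M1)%N -> (0 < M2)%N ->
  ((ln (M1 * M2)%:R)%:E * total_correct s + ((M1 * M2)%:R * (N%:R / 2 + 1))%:E <=
   ((M1 * M2)%:R * (2 + N%:R * ln (s' / s) + N%:R * s ^+ 2 / (2 * s' ^+ 2)))%:E +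
   ((2 * s' ^+ 2)^-1)%:E * total_energy c s (fun w1 w2 h => (x1 w1 w2 h + x2 w1 w2 h) ^+ 2)%R)%E.
Proof.
move=> s0 ss' M10 M20.
have := @noise_expect_sum_correct R ('I_M1 * 'I_M2)%type s s' N
  (fun p => signal c p.1 p.2) (fun=> 0) (fun p => decodes c p.1 p.2) s0 ss'.
rewrite card_prod !card_ord muln_gt0 M10 M20.
rewrite /total_correct /total_energy !pair_big /=.
move=> H; apply: le_trans (H _ _ _ _ _) _ => //.
- by move=> p; exact: seq_measurable_signal.
- by move=> p; exact: seq_measurable_decodes.
- move=> l _; rewrite (bigD1 (dec c (insubd [tuple of nseq N 0] l)))//=.
  rewrite big1 ?addr0; first by case: decodes.
  by move=> p; rewrite /decodes -surjective_pairing eq_sym => /negbTE ->.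
apply: leeD => //; apply: lee_wpmul2l; first by rewrite lee_fin invr_ge0 mulr_ge0// sqr_ge0.
apply: lee_sum => p _; rewrite le_eqVlt; apply/orP; left; apply/eqP.
apply: eq_noise_expect => l _; congr EFin; rewrite !run_sumE.
by apply: eq_bigr => i _; rewrite subr0.
Qed.

(** Applied for each [w1] separately. The reference input [(1 + a) * x1] is a function of [w1] and
    the past outputs, so it hides only message 2, and the true input differs from it by
    [x2 - a * x1]. *)
Lemma total_correct_rate2 s s' (a : R) : 0 < s -> s <= s' -> (0 < M2)%N ->
  ((ln M2%:R)%:E * total_correct s + ((M1 * M2)%:R * (N%:R / 2 + 1))%:E <=
   ((M1 * M2)%:R * (2 + N%:R * ln (s' / s) + N%:R * s ^+ 2 / (2 * s' ^+ 2)))%:E +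
   ((2 * s' ^+ 2)^-1)%:E *
     total_energy c s (fun w1 w2 h => (x2 w1 w2 h - a * x1 w1 w2 h) ^+ 2)%R)%E.
Proof.
move=> s0 ss' M20.
have H w1 := @noise_expect_sum_correct R 'I_M2 s s' N (signal c w1)
  (fun h => (1 + a) * signal1 c w1 h) (decodes c w1) s0 ss'.
have lnM2 : 0 <= ln M2%:R :> R by rewrite ln_ge0// ler1n.
rewrite /total_correct /total_energy.
rewrite ge0_sume_distrr; last first.
  by move=> w1 _; apply: sume_ge0 => w2 _; apply: noise_expect_ge0 => l; rewrite lee_fin.
rewrite ge0_sume_distrr; last first.
  move=> w1 _; apply: sume_ge0 => w2 _; apply: noise_expect_ge0 => l.
  by rewrite lee_fin run_sum_ge0// => h _; exact: sqr_ge0.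
have cst (k : R) : (((M1 * M2)%:R * k)%:E = \sum_(w1 < M1) (M2%:R * k)%:E)%E.
  by rewrite sumEFin sumr_const card_ord natrM -mulrA mulr_natl.
rewrite !cst -!big_split /=; apply: lee_sum => w1 _.
move: {H}(H w1); rewrite !card_ord => H.
apply: le_trans (H _ _ _ _ _) _ => //.
- by move=> w2; exact: seq_measurable_signal.
- by move=> n; apply: measurable_funM => //; exact: seq_measurable_signal1.
- by move=> w2; exact: seq_measurable_decodes.
- move=> l _; pose d := dec c (insubd [tuple of nseq N 0] l).
  rewrite (bigD1 d.2)//= big1 ?addr0; first by case: decodes.
  by move=> w2; rewrite /decodes -/d -pair_eqE /pair_eq /= eq_sym => /negbTE ->; rewrite andbF.
apply: leeD => //; apply: lee_wpmul2l; first by rewrite lee_fin invr_ge0 mulr_ge0// sqr_ge0.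
apply: lee_sum => w2 _; rewrite le_eqVlt; apply/orP; left; apply/eqP.
apply: eq_noise_expect => l _; congr EFin; rewrite !run_sumE.
apply: eq_bigr => i _; congr (_ ^+ 2); rewrite /signal /x1 /x2; ring.
Qed.

End CodeConverse.

(** * Choice of the reference variance and of the correlation *)

Section Region.
Context {R : realType}.

(** With [s' ^+ 2 = s ^+ 2 + T], the sum [(n * T + n * s ^+ 2) / (2 * s' ^+ 2)] is exactly [n / 2]
    and cancels the same term on the left; of the additive constants, [2 - 1] survives. *)
Lemma rate_bound (n M lnM CT D T s s' eps : R) : 0 < s -> 0 <= T -> s' ^+ 2 = s ^+ 2 + T ->
  0 < M -> 0 <= lnM -> (1 - eps) * M <= CT -> D <= M * n * T -> 
  lnM * CT + M * (n / 2 + 1) <=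
    M * (2 + n * ln (s' / s) + n * s ^+ 2 / (2 * s' ^+ 2)) + (2 * s' ^+ 2)^-1 * D ->
  (1 - eps) * lnM <= 1 + n * ln (s' / s).
Proof.
move=> s0 T0 s'E M0 lnM0 CTge Dle H.
have sT : 0 < s ^+ 2 + T by rewrite ltr_wpDr// exprn_gt0.
rewrite -(ler_pM2l M0); move: H; rewrite s'E => H.
have H1 : lnM * ((1 - eps) * M) <= lnM * CT by rewrite ler_wpM2l.
have iv0 : 0 <= (2 * (s ^+ 2 + T))^-1 by rewrite invr_ge0 mulr_ge0// ltW.
have H2 : (2 * (s ^+ 2 + T))^-1 * D <= (2 * (s ^+ 2 + T))^-1 * (M * n * T) by rewrite ler_wpM2l.
have H3 : (2 * (s ^+ 2 + T))^-1 * (M * n * T) + M * (n * s ^+ 2 / (2 * (s ^+ 2 + T))) = M * (n / 2).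
  by field; rewrite gt_eqF.
lra.
Qed.

Lemma ln_scale (s T : R) : 0 < s -> 0 <= T ->
  ln (s * Num.sqrt (1 + T / s ^+ 2) / s) = ln (1 + T / s ^+ 2) / 2.
Proof.
move=> s0 T0; have u0 : 0 < 1 + T / s ^+ 2.
  by rewrite ltr_wpDr// divr_ge0// sqr_ge0.
rewrite mulrAC divff ?gt_eqF// mul1r -[in RHS](sqr_sqrtr (ltW u0)) lnXn ?sqrtr_gt0//.
by move: (ln _) => y; field.
Qed.

Lemma sqr_scale (s T : R) : 0 < s -> 0 <= T ->
  (s * Num.sqrt (1 + T / s ^+ 2)) ^+ 2 = s ^+ 2 + T.
Proof.
move=> s0 T0; rewrite exprMn sqr_sqrtr; last by rewrite addr_ge0// divr_ge0// sqr_ge0.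
by field; rewrite gt_eqF.
Qed.

Lemma le_scale (s T : R) : 0 < s -> 0 <= T -> s <= s * Num.sqrt (1 + T / s ^+ 2).
Proof.
move=> s0 T0; rewrite ler_pMr// -[leLHS]sqrtr1 ler_wsqrtr// lerDl.
by rewrite divr_ge0// sqr_ge0.
Qed.

Lemma le_avg_fin (a b : R) (x : \bar R) : 0 < a -> (0 <= x)%E -> (a%:E * x <= b%:E)%E ->
  exists2 y, x = y%:E & 0 <= y <= b / a.
Proof.
move=> a0; case: x => [y| |]//; last by rewrite gt0_muley ?lte_fin.
by rewrite -EFinM !lee_fin => y0 yb; exists y => //; rewrite y0 ler_pdivlMr// mulrC.
Qed.

(** One [rho] must serve both bounds, so it is read off from the energy [S] of the sum of the
    inputs: a larger [S] relaxes the sum-rate bound, but it forces correlation and so lowers the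
    energy of the residual [x2 - a * x1]. *)
Lemma converse_code N M1 M2 (c : @fb_code R N M1 M2) (P1 P2 s eps : R) :
  0 < P1 -> 0 < P2 -> 0 < s -> (0 < N)%N -> (0 < M1)%N -> (0 < M2)%N ->
  fb_code_measurable c ->
  (avg_power1 s c <= P1%:E)%E -> (avg_power2 s c <= P2%:E)%E -> (error_prob s c <= eps%:E)%E ->
  exists rho, [/\ 0 <= rho <= 1,
    (1 - eps) * ln M2%:R <= 1 + N%:R * (ln (1 + P2 * (1 - rho ^+ 2) / s ^+ 2) / 2) &
    (1 - eps) * ln (M1 * M2)%:R <=
      1 + N%:R * (ln (1 + (P1 + P2 + 2 * Num.sqrt (P1 * P2) * rho) / s ^+ 2) / 2)].
Proof.
move=> P10 P20 s0 N0 M10 M20 mc.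
have [M ME] : exists M : R, M = (M1 * M2)%:R by eexists.
have [n nE] : exists n : R, n = N%:R by eexists.
have M0 : 0 < M by rewrite ME ltr0n muln_gt0 M10.
have n0 : 0 < n by rewrite nE ltr0n.
rewrite -ME -nE.
pose x1 (w1 : 'I_M1) (w2 : 'I_M2) := signal1 c w1; pose x2 := signal2 c.
have m1 w1 w2 : seq_measurable (x1 w1 w2) by exact: seq_measurable_signal1.
have m2 w1 w2 : seq_measurable (x2 w1 w2) by exact: seq_measurable_signal2.
have msq (q : 'I_M1 -> 'I_M2 -> seq R -> R) : (forall w1 w2, seq_measurable (q w1 w2)) ->
    forall w1 w2, seq_measurable (fun h => q w1 w2 h ^+ 2).
  by move=> mq w1 w2 p; apply: measurable_funX; exact: mq.
have sq0 (q : 'I_M1 -> 'I_M2 -> seq R -> R) w1 w2 h : 0 <= q w1 w2 h ^+ 2 by exact: sqr_ge0.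
have nM0 : 0 < n^-1 * M^-1 by rewrite mulr_gt0 ?invr_gt0.
have nMV P : P / (n^-1 * M^-1) = M * n * P by field; rewrite !gt_eqF.
rewrite /avg_power1 (avg_powerE mc s (p := input1 c) (q := x1)); first last.
- exact: m1.
- by move=> w1 w2 l i il; rewrite input1E.
rewrite -nE -ME => /(le_avg_fin nM0 (total_energy_ge0 _ _ (sq0 x1))); rewrite nMV => -[E1 E1E /andP[E10 E1le]].
rewrite /avg_power2 (avg_powerE mc s (p := input2 c) (q := x2)); first last.
- exact: m2.
- by move=> w1 w2 l i il; rewrite input2E.
rewrite -nE -ME => /(le_avg_fin nM0 (total_energy_ge0 _ _ (sq0 x2))); rewrite nMV => -[E2 E2E /andP[E20 E2le]].
have iM0 : 0 < M^-1 by rewrite invr_gt0.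
rewrite error_probE -ME => /(le_avg_fin iM0) []; last move=> ET ETE /andP[_ ETle].
  by do 2 (apply: sume_ge0 => ? _); apply: noise_expect_ge0 => l; rewrite lee_fin.
have := sum_correct_error mc s; rewrite ETE -ME -/(total_correct c s).
have : (0 <= total_correct c s)%E.
  by do 2 (apply: sume_ge0 => ? _); apply: noise_expect_ge0 => l; rewrite lee_fin.
case CTE : (total_correct c s) => [CT| |]//= CT0; rewrite -EFinD => -[CTET].
have CTge : (1 - eps) * M <= CT.
  by move: ETle; rewrite invrK mulrBl mul1r; lra.
set ES := total_energy c s (fun w1 w2 h => (x1 w1 w2 h + x2 w1 w2 h) ^+ 2).
(* The family of bounds [(a + b)^2 <= (1 + t) a^2 + (1 + 1/t) b^2] replaces the Cauchy-Schwarz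
   inequality, which would involve the signed product of the inputs. *)
have cauchy t : 0 < t -> (ES <= ((1 + t) * E1 + (1 + t^-1) * E2)%:E)%E.
  move=> t0; have tV0 : 0 < t^-1 by rewrite invr_gt0.
  rewrite EFinD !EFinM -E1E -E2E -total_energyZ//; last 2 first.
  - by rewrite addr_ge0// ltW.
  - exact: msq.
  rewrite -total_energyZ//; last 2 first.
  - by rewrite addr_ge0// ltW.
  - exact: msq.
  rewrite -total_energyD//; first last.
  - by move=> w1 w2 p; apply: measurable_funM => //; apply: msq.
  - by move=> w1 w2 p; apply: measurable_funM => //; apply: msq.
  - by move=> w1 w2 h; rewrite mulr_ge0// addr_ge0// ltW.
  - by move=> w1 w2 h; rewrite mulr_ge0// addr_ge0// ltW.
  apply: total_energy_le => //.
  - move=> w1 w2 h; rewrite sqr_ge0 /=; move: (x1 w1 w2 h) (x2 w1 w2 h) => a b.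
    have : 0 <= t^-1 * (t * a - b) ^+ 2 by rewrite mulr_ge0 ?sqr_ge0// ltW.
    have -> : t^-1 * (t * a - b) ^+ 2 = t * a ^+ 2 + t^-1 * b ^+ 2 - 2 * (a * b).
      by field; rewrite gt_eqF.
    lra.
  - by apply: msq => w1 w2 p; apply: measurable_funD; [exact: m1|exact: m2].
  - move=> w1 w2 p; apply: measurable_funD; apply: measurable_funM => //.
      exact: (msq x1).
    exact: (msq x2).
have ES0 : (0 <= ES)%E by apply: total_energy_ge0 => w1 w2 h; exact: sqr_ge0.
have [S SE S0] : exists2 S, ES = S%:E & 0 <= S.
  have := cauchy 1 ltr01; case: (ES) ES0 => [S| |]//; rewrite lee_fin => S0 _.
  by exists S.
have Sle t : 0 < t -> S <= (1 + t) * E1 + (1 + t^-1) * E2.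
  by move=> /cauchy; rewrite SE lee_fin.
pose g := Num.sqrt (P1 * P2).
have g0 : 0 < g by rewrite sqrtr_gt0 mulr_gt0.
have g2 : g ^+ 2 = P1 * P2 by rewrite sqr_sqrtr// mulr_ge0// ltW.
have Mn0 : 0 < M * n by rewrite mulr_gt0.
(* [t = g / P1] is the square root of [P2 / P1], which minimises [(1 + t) P1 + (1 + 1/t) P2]. *)
have SMn : S / (M * n) <= P1 + P2 + 2 * g.
  rewrite ler_pdivrMr//; have := Sle (g / P1) (divr_gt0 g0 P10).
  have -> : (g / P1)^-1 = g / P2.
    have : P1 = g ^+ 2 / P2 by rewrite g2; field; rewrite gt_eqF.
    by move=> ->; field; rewrite !gt_eqF.
  have a1 : (1 + g / P1) * E1 <= (1 + g / P1) * (M * n * P1).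
    by rewrite ler_wpM2l// addr_ge0// divr_ge0// ltW.
  have a2 : (1 + g / P2) * E2 <= (1 + g / P2) * (M * n * P2).
    by rewrite ler_wpM2l// addr_ge0// divr_ge0// ltW.
  have b1 : (1 + g / P1) * (M * n * P1) = M * n * (P1 + g) by field; rewrite gt_eqF.
  have b2 : (1 + g / P2) * (M * n * P2) = M * n * (P2 + g) by field; rewrite gt_eqF.
  lra.
(* [d] is the nonnegative part of the cross-correlation of the two inputs, as
   allowed by the power constraints, and [a * X1] the linear prediction of [X2]. *)
pose d := Num.max 0 ((S / (M * n) - P1 - P2) / 2).
have d0 : 0 <= d by rewrite le_max lexx.
have dg : d <= g by rewrite ge_max ltW//=; lra.
have dS : S <= M * n * (P1 + P2 + 2 * d).
  rewrite mulrC -ler_pdivrMr//.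
  have : (S / (M * n) - P1 - P2) / 2 <= d by rewrite le_max lexx orbT.
  lra.
pose a := d / P1; have a0 : 0 <= a by rewrite divr_ge0// ltW.
pose rho := d / g.
have rho0 : 0 <= rho by rewrite divr_ge0// ltW.
have rho1 : rho <= 1 by rewrite ler_pdivrMr// mul1r.
have rhoE : g * rho = d by rewrite /rho; field; rewrite gt_eqF.
have T2E : P2 * (1 - rho ^+ 2) = P2 - d ^+ 2 / P1.
  rewrite /rho expr_div_n g2; field; rewrite !gt_eqF//.
set T2 := P2 * (1 - rho ^+ 2).
have T20 : 0 <= T2.
  by apply: mulr_ge0; [exact: ltW|rewrite subr_ge0 expr_le1].
set T1 := P1 + P2 + 2 * g * rho.
have T10 : 0 <= T1.
  have : 0 <= 2 * g * rho by rewrite mulr_ge0// mulr_ge0// ltW.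
  by rewrite /T1; lra.
exists rho; split; first by rewrite rho0.
- set ED := total_energy c s (fun w1 w2 h => (x2 w1 w2 h - a * x1 w1 w2 h) ^+ 2).
  have mD w1 w2 : seq_measurable (fun h => x2 w1 w2 h - a * x1 w1 w2 h).
    move=> p; apply: measurable_funB; first exact: m2.
    by apply: measurable_funM => //; exact: m1.
  have mS w1 w2 : seq_measurable (fun h => x1 w1 w2 h + x2 w1 w2 h).
    by move=> p; apply: measurable_funD; [exact: m1|exact: m2].
  have aa0 : 0 <= a * (1 + a) by rewrite mulr_ge0// addr_ge0.
  have a10 : 0 <= 1 + a by rewrite addr_ge0.
  have EDE : (ED + (a * S)%:E = ((1 + a) * E2 + a * (1 + a) * E1)%:E)%E.
    rewrite EFinD [(a * S)%:E]EFinM [((1 + a) * E2)%:E]EFinM [(_ * E1)%:E]EFinM.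
    rewrite -SE -E1E -E2E.
    rewrite -(total_energyZ mc s a0 (sq0 _) (msq _ mS)).
    rewrite -(total_energyZ mc s a10 (sq0 x2) (msq _ m2)).
    rewrite -(total_energyZ mc s aa0 (sq0 x1) (msq _ m1)).
    have mZ (k : R) (q : 'I_M1 -> 'I_M2 -> seq R -> R) : (forall w1 w2, seq_measurable (q w1 w2)) ->
        forall w1 w2, seq_measurable (fun h => k * (q w1 w2 h ^+ 2)).
      by move=> mq w1 w2 p; apply: measurable_funM => //; exact: (msq q mq).
    have kZ (k : R) (q : 'I_M1 -> 'I_M2 -> seq R -> R) : 0 <= k ->
        forall w1 w2 h, 0 <= k * q w1 w2 h ^+ 2.
      by move=> k0 w1 w2 h; rewrite mulr_ge0// sqr_ge0.
    (* (x2 - a x1)^2 + a (x1 + x2)^2 = (1 + a) x2^2 + a (1 + a) x1^2 avoids the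
       signed cross term. *)
    have L := total_energyD mc s (sq0 _) (kZ a _ a0) (msq _ mD) (mZ a _ mS).
    have L' := total_energyD mc s (kZ _ _ a10) (kZ _ _ aa0) (mZ (1 + a) _ m2) (mZ (a * (1 + a)) _ m1).
    by rewrite -[LHS]L -[RHS]L'; apply: eq_total_energy => w1 w2 h; ring.
  have [D DE] : exists D, ED = D%:E.
    move: EDE; have : (0 <= ED)%E by apply: total_energy_ge0 => w1 w2 h; exact: sqr_ge0.
    by case: (ED) => [D| |]//; exists D.
  have Dle : D <= M * n * T2.
    move: EDE; rewrite DE -EFinD => -[] DSE.
    have b2 : (1 + a) * E2 <= (1 + a) * (M * n * P2) by rewrite ler_wpM2l.
    have b1 : a * (1 + a) * E1 <= a * (1 + a) * (M * n * P1) by rewrite ler_wpM2l.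
    (* This is the converse direction of [dS]. If [d = 0] then [a = 0] and both sides vanish;
       otherwise [d] was defined so that [S] equals the bound. *)
    have aS : a * (M * n * (P1 + P2 + 2 * d)) <= a * S.
      rewrite /a /d; case: (lerP ((S / (M * n) - P1 - P2) / 2) 0) => [_|dpos].
        by rewrite !mul0r.
      apply: ler_wpM2l; first by rewrite divr_ge0// ltW.
      by rewrite le_eqVlt; apply/orP; left; apply/eqP; field; rewrite !gt_eqF.
    have : (1 + a) * (M * n * P2) + a * (1 + a) * (M * n * P1) -
        a * (M * n * (P1 + P2 + 2 * d)) = M * n * (P2 - d ^+ 2 / P1).
      by rewrite /a; field; rewrite gt_eqF.
    rewrite -T2E -/T2; lra.
  have := @total_correct_rate2 R N M1 M2 c mc s _ a s0 (le_scale s0 T20) M20.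
  rewrite -/x1 -/x2 -ME -nE CTE -/(x1 _ _) -/ED DE -!EFinM -!EFinD lee_fin => H.
  rewrite -(ln_scale s0 T20).
  apply: (rate_bound s0 T20 (sqr_scale s0 T20) M0 _ CTge Dle H).
  by rewrite ln_ge0// ler1n.
- have := @total_correct_sum_rate R N M1 M2 c mc s _ s0 (le_scale s0 T10) M10 M20.
  rewrite -/x1 -/x2 -ME -nE CTE -/ES SE -!EFinM -!EFinD lee_fin => H.
  have T1E : T1 = P1 + P2 + 2 * d by rewrite /T1 -mulrA rhoE.
  have Sle1 : S <= M * n * T1 by rewrite T1E.
  rewrite -(ln_scale s0 T10).
  apply: (rate_bound s0 T10 (sqr_scale s0 T10) M0 _ CTge Sle1 H).
  by rewrite ln_ge0// ME ler1n muln_gt0 M10.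
Qed.

End Region.

(** * The converse for the region *)

Section ConverseRegion.
Context {R : realType}.
Import numFieldNormedType.Exports.

Lemma continuous_ln_comp (f : R -> R) (x : R) : 0 < f x -> {for x, continuous f} ->
  {for x, continuous (fun y => ln (f y) / 2)}.
Proof.
move=> fx cf; apply: cvgM; last exact: cvg_cst.
by apply: continuous_comp => //; exact: continuous_ln.
Qed.

Lemma achievable_region (P1 P2 s R1 R2 : R) : 0 < P1 -> 0 < P2 -> 0 < s ->
  achievable P1 P2 s R1 R2 -> nofb_region P1 P2 s (R1, R2).
Proof.
move=> P10 P20 s0 [R10 [R20 ach]].
have ln20 : 0 < ln 2 :> R by rewrite ln_gt0// ltr1n.
pose a2 (rho : R) := 1 + P2 * (1 - rho ^+ 2) / s ^+ 2.
pose a1 (rho : R) := 1 + (P1 + P2 + 2 * Num.sqrt (P1 * P2) * rho) / s ^+ 2.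
(* The loss at level [eps] consists of [1 / N <= eps] and of [eps] times a rate; [eps * K] covers
   both. *)
pose K := 1 + (R1 + R2) * ln 2.
have approx eps : 0 < eps < 1 -> exists rho, [/\ 0 <= rho <= 1,
    R2 * ln 2 <= ln (a2 rho) / 2 + eps * K &
    (R1 + R2) * ln 2 <= ln (a1 rho) / 2 + eps * K].
  move=> /andP[eps0 eps1]; have [N0 HN] := ach _ eps0.
  pose N := maxn N0 (Num.truncn eps^-1).+1.
  have N_gt0 : (0 < N)%N by rewrite leq_max orbT.
  have NV : N%:R^-1 <= eps :> R.
    rewrite -[leRHS]invrK lef_pV2 ?posrE ?invr_gt0 ?ltr0n//.
    apply/ltW/(lt_le_trans (truncnS_gt _)).
    by rewrite ler_nat leq_max leqnn orbT.
  have [M1 [M2 [c [M10 [M20 [R1M [R2M [mc [c1 [c2 ce]]]]]]]]]] :=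
    HN N (leq_maxl _ _) N_gt0.
  have [rho [rho01 H2 H1]] := converse_code P10 P20 s0 N_gt0 M10 M20 mc c1 c2 ce.
  exists rho; split => //.
  - have NR0 : 0 < N%:R :> R by rewrite ltr0n.
    have R2N : N%:R * (R2 * ln 2) <= ln M2%:R.
      by move: R2M; rewrite /log2 ler_pdivlMr// ler_pdivlMr// mulrAC mulrC mulrA.
    have : (1 - eps) * (R2 * ln 2) <= N%:R^-1 + ln (a2 rho) / 2.
      rewrite -(ler_pM2l NR0) mulrDr mulfV ?gt_eqF// mulrCA.
      by apply: le_trans H2; apply: ler_wpM2l => //; rewrite subr_ge0 ltW.
    rewrite /K.
    have : 0 <= R1 * ln 2 * eps by rewrite !mulr_ge0// ltW.
    lra.
  - have NR0 : 0 < N%:R :> R by rewrite ltr0n.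
    have R2N : N%:R * (R2 * ln 2) <= ln M2%:R.
      by move: R2M; rewrite /log2 ler_pdivlMr// ler_pdivlMr// mulrAC mulrC mulrA.
    have R1N : N%:R * (R1 * ln 2) <= ln M1%:R.
      by move: R1M; rewrite /log2 ler_pdivlMr// ler_pdivlMr// mulrAC mulrC mulrA.
    have lnM : ln (M1 * M2)%:R = ln M1%:R + ln M2%:R :> R.
      by rewrite natrM lnM ?posrE ?ltr0n.
    have : (1 - eps) * ((R1 + R2) * ln 2) <= N%:R^-1 + ln (a1 rho) / 2.
      rewrite -(ler_pM2l NR0) mulrDr mulfV ?gt_eqF// mulrCA.
      apply: le_trans H1; apply: ler_wpM2l; first by rewrite subr_ge0 ltW.
      rewrite lnM; lra.
    rewrite /K.
    lra.
pose f2 (rho : R) := ln (a2 rho) / 2 - R2 * ln 2.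
pose f1 (rho : R) := ln (a1 rho) / 2 - (R1 + R2) * ln 2.
have s20 : 0 < s ^+ 2 by rewrite exprn_gt0.
have a2_gt0 rho : rho \in `[0, 1]%R -> 0 < a2 rho.
  rewrite in_itv/= => /andP[rho0 rho1]; rewrite ltr_wpDr// divr_ge0//; last exact: ltW.
  by apply: mulr_ge0; [exact: ltW|rewrite subr_ge0 expr_le1].
have a1_gt0 rho : rho \in `[0, 1]%R -> 0 < a1 rho.
  rewrite in_itv/= => /andP[rho0 rho1]; rewrite ltr_wpDr// divr_ge0//; last exact: ltW.
  have : 0 <= 2 * Num.sqrt (P1 * P2) * rho by rewrite !mulr_ge0 ?sqrtr_ge0.
  by move: (ltW P10) (ltW P20); lra.
(* The minimum merges the two bounds into one continuous function, so that a single maximiser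
   satisfies both; its value is at least [- e] for every [e > 0]. *)
have [|rho rho01 rho_max] := @EVT_max R (fun r => Num.min (f2 r) (f1 r)) 0 1 ler01.
  apply: continuous_in_subspaceT => r; rewrite inE /= => r01.
  apply: continuous_min.
  - apply: (@cvgB _ R^o); last exact: cvg_cst.
    apply: continuous_ln_comp; first exact: a2_gt0.
    apply: cvgD; first exact: cvg_cst.
    apply: cvgM; last exact: cvg_cst.
    apply: cvgM; first exact: cvg_cst.
    apply: (@cvgB _ R^o); first exact: cvg_cst.
    exact: sqr_continuous.
  - apply: (@cvgB _ R^o); last exact: cvg_cst.
    apply: continuous_ln_comp; first exact: a1_gt0.
    apply: cvgD; first exact: cvg_cst.
    apply: cvgM; last exact: cvg_cst.
    apply: cvgD; first exact: cvg_cst.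
    by apply: cvgM; [exact: cvg_cst|exact: cvg_id].
have K0 : 0 < K by rewrite ltr_wpDr// mulr_ge0 ?addr_ge0// ltW.
have : 0 <= Num.min (f2 rho) (f1 rho).
  apply/ler_addgt0Pr => e e0.
  pose eps := Num.min (2^-1) (e / K).
  have eps01 : 0 < eps < 1.
    rewrite lt_min invr_gt0 ltr0n divr_gt0//= gt_min; apply/orP; left; lra.
  have epsK : eps * K <= e by rewrite -ler_pdivlMr// ge_min lexx orbT.
  have [r [r01 H2 H1]] := approx _ eps01.
  have := rho_max r; rewrite in_itv/= r01 => /(_ isT).
  have : - e <= Num.min (f2 r) (f1 r) by rewrite le_min /f2 /f1; apply/andP; split; lra.
  lra.
rewrite le_min => /andP[f2rho f1rho].
exists rho; split => //=.
- rewrite /log2 mulrA ler_pdivlMr//; rewrite /f2 /a2 in f2rho; lra.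
- rewrite /log2 mulrA ler_pdivlMr//; rewrite /f1 /a1 in f1rho; lra.
Qed.

End ConverseRegion.

(** * The linear feedback scheme *)

Section Grid.
Context {R : realType}.

(** The centres of [n] equal cells of the interval from [-1] to [1]. Decoding uses the spacing
    [2 / n]; the power bounds use that squares are at most 1 and that the mean is 0. *)
Definition grid n (i : nat) : R := (2 * i%:R + 1 - n%:R) / n%:R.

Lemma grid_sqr_le1 n i : (i < n)%N -> grid n i ^+ 2 <= 1.
Proof.
move=> i_n; have n0 : 0 < n%:R :> R by rewrite ltr0n (leq_ltn_trans _ i_n).
have i1 : i%:R + 1 <= n%:R :> R by rewrite natr1 ler_nat.
have i0 : 0 <= i%:R :> R by [].
have [x1 x1'] : - 1 <= grid n i /\ grid n i <= 1.
  by rewrite /grid ler_pdivlMr// ler_pdivrMr//; split; lra.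
have : 0 <= (1 - grid n i) * (1 + grid n i) by rewrite mulr_ge0//; lra.
lra.
Qed.

Lemma grid_dist n i j : (0 < n)%N -> i != j -> 2 / n%:R <= `|grid n i - grid n j|.
Proof.
move=> n_gt0 ij; have n0 : 0 < n%:R :> R by rewrite ltr0n.
have -> : grid n i - grid n j = (i%:R - j%:R) * (2 / n%:R).
  by rewrite /grid; field; rewrite gt_eqF.
rewrite normrM (gtr0_norm (divr_gt0 _ n0))// ler_pMl ?divr_gt0//.
wlog ltij : i j ij / (i < j)%N => [H|].
  have [ij'|ji|ijE] := ltngtP i j; first exact: H.
    by rewrite distrC; apply: H => //; rewrite eq_sym.
  by rewrite ijE eqxx in ij.
rewrite distrC ger0_norm ?subr_ge0 ?ler_nat 1?ltnW//.
by rewrite -natrB 1?ltnW// ler1n subn_gt0.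
Qed.

Lemma sum_grid n : \sum_(i < n) grid n i = 0 :> R.
Proof.
suff : \sum_(i < n) grid n i = - \sum_(i < n) grid n i :> R by move=> ?; lra.
rewrite {1}(reindex_inj rev_ord_inj) -sumrN; apply: eq_bigr => i _ /=.
rewrite /grid -mulNr; congr (_ / _).
by rewrite natrB ?ltn_ord// -natr1; lra.
Qed.

End Grid.

(** * Recursion of the rescaled estimation errors *)

Section Scheme.
Context {R : realType}.
Variables (s G tau q g r t : R).
Hypothesis s0 : 0 < s.
Hypothesis qg : q ^+ 2 + g ^+ 2 * (tau ^+ 2 + s ^+ 2) = 1.
Hypothesis rt : r ^+ 2 + t ^+ 2 * s ^+ 2 = 1.
Hypothesis ts : t * s ^+ 2 = r * tau.

(** The state computed from outputs. Substituting [y = G * p.1 + tau * p.2 + z] yields [noise_step],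
    the same state in terms of the noise. *)
Definition feedback_step (p : R * R) (y : R) : R * R :=
  ((q + g * G) * p.1 - g * y, (r + t * tau) * p.2 - t * (y - G * p.1)).

Definition noise_step (p : R * R) (z : R) : R * R :=
  (q * p.1 - g * (tau * p.2 + z), r * p.2 - t * z).

(** [p] is a hypothetical initial state, one per message pair: the true one keeps a controlled
    second moment, while the others drift away from it geometrically. *)
Definition track p h := foldl feedback_step p h.
Definition scheme p h := G * (track p h).1 + tau * (track p h).2.

Lemma track_run p l : track p (run (scheme p) l) = foldl noise_step p l.
Proof.
elim/last_ind: l => // l z IH; rewrite run_rcons /track !foldl_rcons -/(track _ _) /scheme IH.
by rewrite /feedback_step /noise_step; congr pair; ring.
Qed.

(** The first coordinate never reads the second, so encoder 1 can follow it without knowing message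
    2. *)
Lemma track_fst u v v' h : (track (u, v) h).1 = (track (u, v') h).1.
Proof. by elim/last_ind: h => // h y IH; rewrite /track !foldl_rcons /= -!/(track _ _) IH. Qed.

Lemma track_fst_dist u u' v v' h :
  (track (u, v) h).1 - (track (u', v') h).1 = (q + g * G) ^+ size h * (u - u').
Proof.
elim/last_ind: h => [|h y IH]; first by rewrite mul1r.
rewrite /track !foldl_rcons /= -!/(track _ _) size_rcons exprS -mulrA -IH; ring.
Qed.

Lemma track_snd_dist u v v' h :
  (track (u, v) h).2 - (track (u, v') h).2 = (r + t * tau) ^+ size h * (v - v').
Proof.
elim/last_ind: h => [|h y IH]; first by rewrite mul1r.
rewrite /track !foldl_rcons /= -!/(track _ _) size_rcons exprS -mulrA -IH.
by rewrite (track_fst u v v' h); ring.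
Qed.

Lemma seq_measurable_track p : seq_measurable (track p).
Proof.
apply: seq_measurable_rcons => n mT.
have mT1 : measurable_fun [set: n.-tuple R * R] (fun x => (track p x.1).1).
  exact: (measurableT_comp measurable_fst (measurableT_comp mT measurable_fst)).
have mT2 : measurable_fun [set: n.-tuple R * R] (fun x => (track p x.1).2).
  exact: (measurableT_comp measurable_snd (measurableT_comp mT measurable_fst)).
rewrite [X in measurable_fun _ X](_ : _ =
    fun x : n.-tuple R * R => feedback_step (track p x.1) x.2); last first.
  by apply/funext => x; rewrite /track foldl_rcons.
apply/measurable_fun_pair => /=.
  apply: measurable_funB; apply: measurable_funM => //; exact: measurable_snd.
apply: measurable_funB; apply: measurable_funM => //.
apply: measurable_funB; first exact: measurable_snd.
exact: measurable_funM.
Qed.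

Lemma seq_measurable_track_fst p : seq_measurable (fun h => (track p h).1).
Proof.
move=> n; have mT := seq_measurable_track p (n := n).
exact: (measurableT_comp measurable_fst mT).
Qed.

Lemma seq_measurable_track_snd p : seq_measurable (fun h => (track p h).2).
Proof.
move=> n; have mT := seq_measurable_track p (n := n).
exact: (measurableT_comp measurable_snd mT).
Qed.

Lemma seq_measurable_track_lin p (a b : R) :
  seq_measurable (fun h => a * (track p h).1 + b * (track p h).2).
Proof.
move=> n; apply: measurable_funD; apply: measurable_funM => //.
  exact: seq_measurable_track_fst.
exact: seq_measurable_track_snd.
Qed.

(* The second moment of a linear functional of the state stays a quadratic form
   in the initial state plus a constant, and the balance [a^2 + b^2] is kept:
   the standard Gaussian law of the state would be stationary. *)
Lemma noise_expect_track i (a b : R) : exists a' b' K, [/\ 0 <= K, a' ^+ 2 + b' ^+ 2 + K = a ^+ 2 + b ^+ 2 &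
  forall n p, (i <= n)%N ->
  noise_expect s n (fun l => ((a * (foldl noise_step p (take i l)).1 +
     b * (foldl noise_step p (take i l)).2) ^+ 2)%:E) =
  ((a' * p.1 + b' * p.2) ^+ 2 + K)%:E].
Proof.
elim: i => [|i [a' [b' [K [K0 abK IH]]]]].
  exists a, b, 0; split; [by []|by rewrite addr0|move=> n p _].
  rewrite -[RHS](noise_expect_cst s n); apply: eq_noise_expect => l _.
  by rewrite take0 addr0.
(* These coefficients are the functional pulled back through one [noise_step], and the new part of
   [K] is its noise variance. In the balance, the cross term has the factor [t * s ^+ 2 - r * tau],
   which is zero by [ts]. *)
exists (a' * q), (b' * r - a' * g * tau), (K + (a' * g + b' * t) ^+ 2 * s ^+ 2).
split.
- by rewrite addr_ge0// mulr_ge0// sqr_ge0.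
- rewrite -abK.
  have -> : (a' * q) ^+ 2 + (b' * r - a' * g * tau) ^+ 2 + (K + (a' * g + b' * t) ^+ 2 * s ^+ 2) =
    a' ^+ 2 * (q ^+ 2 + g ^+ 2 * (tau ^+ 2 + s ^+ 2)) + b' ^+ 2 * (r ^+ 2 + t ^+ 2 * s ^+ 2) +
    2 * a' * b' * g * (t * s ^+ 2 - r * tau) + K by ring.
  by rewrite qg rt ts; ring.
- move=> [//|n] p i_n; rewrite noise_expectS.
  pose L := a' * q * p.1 + (b' * r - a' * g * tau) * p.2.
  pose k := a' * g + b' * t.
  transitivity (\int[normal_prob 0 s]_z (((L + (- k) * z) ^+ 2)%R%:E + K%:E))%E.
    apply: eq_integral => z _; rewrite -EFinD.
    transitivity (((a' * (noise_step p z).1 + b' * (noise_step p z).2) ^+ 2 + K)%:E).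
      by rewrite -(IH n).
    by congr (_ ^+ 2 + _)%:E; rewrite /noise_step /L /k /=; ring.
  rewrite ge0_integralD//.
  + rewrite normal_second_moment_affine// integral_normal_cst -EFinD sqrrN.
    by rewrite -addrA [_ + K]addrC.
  + by move=> z _; rewrite lee_fin sqr_ge0.
  + exact: measurable_sqr_affine.
Qed.

(** Summing over message 2 kills the term linear in [theta2], and with it the only occurrence of
    [theta1] outside a square. The invariant balance of [noise_expect_track] bounds the rest. *)
Lemma sum_noise_expect_track M (theta2 : 'I_M -> R) theta1 i n (a b : R) :
  theta1 ^+ 2 <= 1 -> \sum_w theta2 w = 0 -> (forall w, theta2 w ^+ 2 <= 1) -> (i <= n)%N ->
  (\sum_w noise_expect s n (fun l => ((a * (foldl noise_step (theta1, theta2 w) (take i l)).1 +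
     b * (foldl noise_step (theta1, theta2 w) (take i l)).2) ^+ 2)%R%:E) <=
   (M%:R * (a ^+ 2 + b ^+ 2))%:E)%E.
Proof.
move=> theta1_le1 sum0 theta2_le1 i_n.
have [a' [b' [K [K0 <- H]]]] := noise_expect_track i a b.
under eq_bigr do rewrite H//=.
rewrite sumEFin lee_fin.
rewrite (eq_bigr (fun w => (a' ^+ 2 * theta1 ^+ 2 + K) + (2 * a' * theta1 * b' * theta2 w + b' ^+ 2 * theta2 w ^+ 2))); last first.
  by move=> w _; ring.
rewrite big_split /= [X in _ + X]big_split /= sumr_const card_ord -!mulr_sumr sum0 mulr0 add0r -[_ *+ M]mulr_natl.
have -> : M%:R * (a' ^+ 2 + b' ^+ 2 + K) = M%:R * (a' ^+ 2 * 1 + K) + b' ^+ 2 * M%:R by ring.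
apply: lerD.
  by rewrite ler_wpM2l// lerD2r ler_wpM2l// sqr_ge0.
rewrite ler_wpM2l ?sqr_ge0// -[leRHS]mulr1 mulr_natl -[X in _ <= _ *+ X]card_ord -sumr_const.
exact: ler_sum.
Qed.

End Scheme.

(** * Power and error probability of the scheme *)

Section SchemeCode.
Context {R : realType}.
Variables (s A B tau q g r t : R) (N M1 M2 act : nat).
Hypothesis s0 : 0 < s.
Hypothesis qg : q ^+ 2 + g ^+ 2 * (tau ^+ 2 + s ^+ 2) = 1.
Hypothesis rt : r ^+ 2 + t ^+ 2 * s ^+ 2 = 1.
Hypothesis ts : t * s ^+ 2 = r * tau.
Hypothesis qV : q + g * (A + B) = q^-1.
Hypothesis rV : r + t * tau = r^-1.
Hypotheses (q0 : 0 < q) (r0 : 0 < r).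
Hypotheses (act_gt0 : (0 < act)%N) (actM1 : (act <= M1)%N) (M2_gt0 : (0 < M2)%N).

Local Notation track := (track (A + B) tau q g r t).
Let start (w1 : 'I_M1) (w2 : 'I_M2) : R * R := (grid act w1, grid M2 w2).

(** For the same outputs, tracks from distinct grid points of user 1 are at least [q^-N * 2 / act]
    apart, hence at least 2 after scaling; radius 1 leaves at most one candidate. The second
    coordinate is scaled likewise. *)
Let near_end (w : 'I_M1 * 'I_M2) (y : N.-tuple R) : bool :=
  [&& (w.1 < act)%N, `|q ^+ N * act%:R * (track (start w.1 w.2) y).1| < 1 &
    `|r ^+ N * M2%:R * (track (start w.1 w.2) y).2| < 1].

Let default : 'I_M1 * 'I_M2 :=
  (widen_ord actM1 (Ordinal act_gt0), Ordinal M2_gt0).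

(* Messages [w1 >= act] are given up: nothing is transmitted for them, which
   lowers the average power by the factor [act / M1]. *)
Definition scheme_code : @fb_code R N M1 M2 := FbCode
  (fun i w1 y => if (w1 < act)%N then A * (track (grid act w1, 0) y).1 else 0)
  (fun i w1 w2 y => if (w1 < act)%N then
     B * (track (start w1 w2) y).1 + tau * (track (start w1 w2) y).2 else 0)
  (fun y => odflt default [pick w | near_end w y]).

Lemma measurable_near_end w : measurable_fun [set: N.-tuple R] (near_end w).
Proof.
have mT1 : measurable_fun [set: N.-tuple R] (fun y => (track (start w.1 w.2) y).1).
  exact: seq_measurable_track_fst.
have mT2 : measurable_fun [set: N.-tuple R] (fun y => (track (start w.1 w.2) y).2).
  exact: seq_measurable_track_snd.
apply: measurable_and; first exact: measurable_cst.
apply: measurable_and; apply: measurable_fun_ltr => //; apply: measurableT_comp => //;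
  exact: measurable_funM.
Qed.

Lemma scheme_code_measurable : fb_code_measurable scheme_code.
Proof.
split; last split.
- move=> i w1 /=; case: (w1 < act)%N => //; apply: measurable_funM => //.
  exact: seq_measurable_track_fst.
- by move=> i w1 w2 /=; case: (w1 < act)%N => //; exact: seq_measurable_track_lin.
(* The decoder sees [y] only through the finite table of values of [near_end], so the preimage is a
   finite union, over tables, of finite intersections. *)
- move=> w; pose f (b : {ffun 'I_M1 * 'I_M2 -> bool}) := odflt default [pick w | b w].
  pose F (y : N.-tuple R) := [ffun w => near_end w y].
  rewrite (_ : _ @^-1` _ = \bigcup_(b in [set b | f b = w])
    \bigcap_(w' in [set: 'I_M1 * 'I_M2]) (near_end w' @^-1` [set b w'])).
    apply: fin_bigcup_measurable => [|b _]; first exact: finite_finset.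
    apply: fin_bigcap_measurable => [|w' _]; first exact: finite_finset.
    by rewrite -[X in measurable X]setTI; exact: measurable_near_end.
  have decE y : dec scheme_code y = f (F y).
    by rewrite /f /=; congr odflt; apply: eq_pick => w'; rewrite ffunE.
  apply/seteqP; split => [y yw|y [b <- Fy]].
    by exists (F y) => [|w' _ /=]; [rewrite /= -decE|rewrite ffunE].
  change (dec scheme_code y = f b); rewrite decE.
  by congr f; apply/ffunP => w'; rewrite ffunE; exact: Fy.
Qed.

Lemma signal1_scheme (w1 : 'I_M1) h :
  signal1 scheme_code w1 h = if (w1 < act)%N then A * (track (grid act w1, 0) h).1 else 0.
Proof. by []. Qed.

Lemma signal2_scheme (w1 : 'I_M1) (w2 : 'I_M2) h :
  signal2 scheme_code w1 w2 h = if (w1 < act)%N then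
    B * (track (start w1 w2) h).1 + tau * (track (start w1 w2) h).2 else 0.
Proof. by []. Qed.

Lemma signal_scheme (w1 : 'I_M1) w2 : (w1 < act)%N ->
  signal scheme_code w1 w2 = scheme (A + B) tau q g r t (start w1 w2).
Proof.
move=> w1a; apply/funext => h; rewrite /signal signal1_scheme signal2_scheme w1a /scheme.
by rewrite (@track_fst _ (A + B) tau q g r t (grid act w1) 0 (grid M2 w2)); ring.
Qed.

Lemma track_scheme (w1 : 'I_M1) w2 l : (w1 < act)%N ->
  track (start w1 w2) (run (signal scheme_code w1 w2) l) =
  foldl (noise_step tau q g r t) (start w1 w2) l.
Proof. by move=> w1a; rewrite signal_scheme// track_run. Qed.

Lemma total_energy_scheme (x : 'I_M1 -> 'I_M2 -> seq R -> R) (a b : R) :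
  (forall w1 w2, seq_measurable (x w1 w2)) ->
  (forall (w1 : 'I_M1) w2 h, x w1 w2 h = if (w1 < act)%N then
     a * (track (start w1 w2) h).1 + b * (track (start w1 w2) h).2 else 0) ->
  (total_energy scheme_code s (fun w1 w2 h => x w1 w2 h ^+ 2)%R <=
    (act%:R * N%:R * M2%:R * (a ^+ 2 + b ^+ 2))%:E)%E.
Proof.
move=> mx xE.
have mrs w1 w2 : seq_measurable (signal scheme_code w1 w2).
  by apply: seq_measurable_signal; exact: scheme_code_measurable.
have inner (w1 : 'I_M1) : (\sum_w2 noise_expect s N
    (fun l => (run_sum (signal scheme_code w1 w2) (fun h _ => x w1 w2 h ^+ 2) l)%:E) <=
    ((w1 < act)%:R * (N%:R * M2%:R * (a ^+ 2 + b ^+ 2)))%:E)%E.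
  case: (ltnP w1 act) => [w1a|w1a]; last first.
    rewrite mul0r big1// => w2 _; rewrite -[RHS](noise_expect_cst s N).
    apply: eq_noise_expect => l _; rewrite run_sumE big1// => i _.
    by rewrite xE ltnNge w1a expr0n.
  rewrite mul1r.
  have -> : (N%:R * M2%:R * (a ^+ 2 + b ^+ 2))%:E =
      (\sum_(i < N) (M2%:R * (a ^+ 2 + b ^+ 2))%:E)%E :> \bar R.
    by rewrite sumEFin sumr_const card_ord -mulrA mulr_natl.
  rewrite (eq_bigr (fun w2 => \sum_(i < N) noise_expect s N (fun l =>
    ((a * (foldl (noise_step tau q g r t) (start w1 w2) (take i l)).1 +
      b * (foldl (noise_step tau q g r t) (start w1 w2) (take i l)).2) ^+ 2)%R%:E))%E); last first.
    move=> w2 _.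
    have trackE i l : (a * (foldl (noise_step tau q g r t) (start w1 w2) (take i l)).1 +
      b * (foldl (noise_step tau q g r t) (start w1 w2) (take i l)).2) =
      x w1 w2 (run (signal scheme_code w1 w2) (take i l)).
      by rewrite xE w1a -track_scheme.
    rewrite -noise_expect_sum; first last.
    - move=> i n; apply/measurable_EFinP; under eq_fun do rewrite trackE.
      apply: measurable_funX.
      apply: (@seq_measurable_take _ _ _ (fun l => x w1 w2 (run (signal scheme_code w1 w2) l))).
      by apply: seq_measurable_run.
    - by move=> i l; rewrite lee_fin sqr_ge0.
    apply: eq_noise_expect => l lN; rewrite run_sumE sumEFin lN; congr EFin.
    by apply: eq_bigr => i _; rewrite trackE.
  rewrite exchange_big; apply: lee_sum => i _.
  apply: (sum_noise_expect_track s0 qg rt ts).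
  - exact: grid_sqr_le1.
  - exact: sum_grid.
  - by move=> w; exact: grid_sqr_le1.
  - exact: ltnW.
apply: le_trans (lee_sum _ (fun w1 _ => inner w1)) _.
rewrite sumEFin lee_fin -mulr_suml -!mulrA ler_wpM2r//.
  by rewrite !mulr_ge0// addr_ge0// sqr_ge0.
rewrite -natr_sum ler_nat -big_mkcond /=.
by rewrite -(@big_ord_widen _ _ _ _ _ (fun=> 1%N) actM1) sum1_card card_ord.
Qed.

Lemma avg_power1_scheme : (0 < N)%N ->
  (avg_power1 s scheme_code <= (act%:R / M1%:R * A ^+ 2)%:E)%E.
Proof.
move=> N0; have mc := scheme_code_measurable.
rewrite /avg_power1 (@avg_powerE _ _ _ _ _ mc s (fun w1 _ => signal1 scheme_code w1)); first last.
- by move=> w1 _; exact: seq_measurable_signal1.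
- by move=> w1 w2 l i il; rewrite input1E.
have M10 : (0 < M1)%N by exact: leq_trans actM1.
apply: (le_trans (lee_wpmul2l _ (@total_energy_scheme (fun w1 _ => signal1 scheme_code w1) A 0 _ _))).
- by rewrite lee_fin mulr_ge0// invr_ge0.
- by move=> w1 _; exact: seq_measurable_signal1.
- move=> w1 w2 h; rewrite signal1_scheme; case: ifP => // _.
  by rewrite (@track_fst _ (A + B) tau q g r t (grid act w1) 0 (grid M2 w2)) mul0r addr0.
rewrite -EFinM lee_fin le_eqVlt; apply/orP; left; apply/eqP.
rewrite natrM expr0n addr0; field.
by rewrite !pnatr_eq0 -!lt0n N0 M10 M2_gt0.
Qed.

Lemma avg_power2_scheme : (0 < N)%N ->
  (avg_power2 s scheme_code <= (act%:R / M1%:R * (B ^+ 2 + tau ^+ 2))%:E)%E.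
Proof.
move=> N0; have mc := scheme_code_measurable.
rewrite /avg_power2 (@avg_powerE _ _ _ _ _ mc s (signal2 scheme_code)); first last.
- by move=> w1 w2; exact: seq_measurable_signal2.
- by move=> w1 w2 l i il; rewrite input2E.
have M10 : (0 < M1)%N by exact: leq_trans actM1.
apply: (le_trans (lee_wpmul2l _ (@total_energy_scheme (signal2 scheme_code) B tau _ _))).
- by rewrite lee_fin mulr_ge0// invr_ge0.
- by move=> w1 w2; exact: seq_measurable_signal2.
- by [].
rewrite -EFinM lee_fin le_eqVlt; apply/orP; left; apply/eqP.
rewrite natrM; field.
by rewrite !pnatr_eq0 -!lt0n N0 M10 M2_gt0.
Qed.

(** Message 1 is settled first, since the gap between first coordinates does not depend on the
    second ones. Only once it agrees do the second coordinates differ by a pure power of [r^-1]. *)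
Lemma near_end_inj w w' y : near_end w y -> near_end w' y -> w = w'.
Proof.
case: w w' => [w1 w2] [w1' w2'] /and3P[/= w1a u1 v1] /and3P[/= w1'a u1' v1'].
have close (x x' : R) : `|x| < 1 -> `|x'| < 1 -> `|x - x'| < 2.
  by rewrite !ltr_norml => /andP[? ?] /andP[? ?]; apply/andP; split; lra.
have far n i j (c : R) : (0 < n)%N -> i != j -> c = n%:R -> 2 <= `|c * (grid n i - grid n j)|.
  move=> n0 ij ->; rewrite normrM ger0_norm// -ler_pdivrMl ?ltr0n// mulrC.
  exact: grid_dist.
have w1E : w1 = w1'.
  apply/val_inj/eqP; apply/negPn/negP => w1w1'.
  have := close _ _ u1 u1'; rewrite -mulrBr track_fst_dist size_tuple qV.
  rewrite exprVn mulrACA mulfV ?mul1r ?expf_neq0 ?gt_eqF//.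
  by apply/negP; rewrite -leNgt; exact: far.
congr pair => //; subst w1'; apply/val_inj/eqP; apply/negPn/negP => w2w2'.
have := close _ _ v1 v1'; rewrite -mulrBr track_snd_dist size_tuple rV.
rewrite exprVn mulrACA mulfV ?mul1r ?expf_neq0 ?gt_eqF//.
by apply/negP; rewrite -leNgt; exact: far.
Qed.

Lemma dec_scheme w y : near_end w y -> dec scheme_code y = w.
Proof.
move=> wy; rewrite /=; case: pickP => [w' w'y|/(_ w)]; last by rewrite wy.
exact: near_end_inj w'y wy.
Qed.

(** Messages beyond [act] are charged as errors outright. For the others, a decoding error forces a
    scaled final coordinate to have absolute value at least 1, so the sum of the two squares
    dominates the error indicator. *)
Lemma error_prob_scheme :
  (error_prob s scheme_code <= ((M1 - act)%:R / M1%:R +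
     ((q ^+ N * act%:R) ^+ 2 + (r ^+ N * M2%:R) ^+ 2))%:E)%E.
Proof.
have mc := scheme_code_measurable.
have M10 : (0 < M1)%N by exact: leq_trans actM1.
set c1 := q ^+ N * act%:R; set c2 := r ^+ N * M2%:R.
have mC (w1 : 'I_M1) w2 : seq_measurable
    (fun l => (~~ decodes scheme_code w1 w2 (run (signal scheme_code w1 w2) l))%:R : R).
  move=> n; rewrite [X in measurable_fun _ X](_ : _ = fun t : n.-tuple R =>
    1 - (decodes scheme_code w1 w2 (run (signal scheme_code w1 w2) t))%:R); last first.
    by apply/funext => y; case: decodes; rewrite ?subrr ?subr0.
  apply: measurable_funB => //.
  apply: (@seq_measurable_run _ _ R (fun l => (decodes scheme_code w1 w2 l)%:R : R)).
    exact: seq_measurable_decodes.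
  exact: seq_measurable_signal.
have inner (w1 : 'I_M1) : (\sum_w2 noise_expect s N (fun l =>
    ((~~ decodes scheme_code w1 w2 (run (signal scheme_code w1 w2) l))%:R)%:E) <=
    ((~~ (w1 < act)%N)%:R * M2%:R + M2%:R * (c1 ^+ 2 + c2 ^+ 2))%:E)%E.
  case: (ltnP w1 act) => [w1a|w1a] /=; last first.
    apply: (@le_trans _ _ (\sum_(w2 < M2) 1%E)).
      apply: lee_sum => w2 _; rewrite -[leRHS](noise_expect_cst s N 1%E).
      apply: (@noise_expect_EFin_le _ _ _ _ (fun=> 1)) => // l _.
      by case: decodes.
    rewrite sumEFin sumr_const card_ord lee_fin mul1r lerDl.
    by rewrite mulr_ge0// addr_ge0// sqr_ge0.
  rewrite mul0r add0r.
  pose F w2 (a b : R) l := (a * (foldl (noise_step tau q g r t) (start w1 w2) (take N l)).1 +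
    b * (foldl (noise_step tau q g r t) (start w1 w2) (take N l)).2) ^+ 2.
  have mF w2 a b : seq_measurable (F w2 a b).
    move=> n; apply: measurable_funX.
    rewrite (_ : (fun _ => _) = fun l : n.-tuple R =>
      a * (track (start w1 w2) (run (signal scheme_code w1 w2) (take N l))).1 +
      b * (track (start w1 w2) (run (signal scheme_code w1 w2) (take N l))).2); last first.
      by apply/funext => l; rewrite track_scheme.
    apply: (@seq_measurable_take _ _ _ (fun l =>
      a * (track (start w1 w2) (run (signal scheme_code w1 w2) l)).1 +
      b * (track (start w1 w2) (run (signal scheme_code w1 w2) l)).2)).
    apply: (seq_measurable_run (seq_measurable_track_lin _ _ _ _ _ _ _ a b)).
    exact: seq_measurable_signal.
  have F0 w2 a b l : 0 <= F w2 a b l by exact: sqr_ge0.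
  have bound a b : (\sum_w2 noise_expect s N (fun l => (F w2 a b l)%:E) <=
      (M2%:R * (a ^+ 2 + b ^+ 2))%:E)%E.
    apply: (sum_noise_expect_track s0 qg rt ts) => //.
    - exact: grid_sqr_le1.
    - exact: sum_grid.
    - by move=> w; exact: grid_sqr_le1.
  have -> : M2%:R * (c1 ^+ 2 + c2 ^+ 2) =
      M2%:R * (c1 ^+ 2 + 0 ^+ 2) + M2%:R * (0 ^+ 2 + c2 ^+ 2) by ring.
  rewrite EFinD; apply: le_trans (leeD (bound c1 0) (bound 0 c2)).
  rewrite -big_split /=; apply: lee_sum => w2 _.
  rewrite -noise_expect_EFinD//.
  apply: noise_expect_EFin_le => //.
  - by move=> l; rewrite addr_ge0.
  - move=> l lN; have lN' : size l == N by apply/eqP.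
    pose y : N.-tuple R := run_tuple (signal scheme_code w1 w2) (Tuple lN').
    have yE : run (signal scheme_code w1 w2) l = y by [].
    rewrite /F -{3 4 5 6}lN take_size -track_scheme// yE !mul0r add0r addr0.
    set e1 := c1 * _; set e2 := c2 * _.
    have [yw|] := boolP (near_end (w1, w2) y).
      by rewrite /decodes valKd (dec_scheme yw) eqxx addr_ge0// sqr_ge0.
    rewrite /near_end /= w1a /= negb_and -!leNgt -/c1 -/c2 -/e1 -/e2 => far.
    apply: (@le_trans _ _ 1); first by case: decodes.
    have sq1 (x : R) : 1 <= `|x| -> 1 <= x ^+ 2.
      by move=> x1; rewrite -real_normK ?num_real// exprn_ege1.
    case/orP: far => /sq1 le1.
      by rewrite (le_trans le1)// lerDl sqr_ge0.
    by rewrite (le_trans le1)// lerDr sqr_ge0.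
  - by move=> n; apply: measurable_funD; exact: mF.
rewrite error_probE.
apply: (le_trans (lee_wpmul2l _ (lee_sum _ (fun w1 _ => inner w1)))).
  by rewrite lee_fin invr_ge0.
rewrite sumEFin -EFinM lee_fin big_split /= sumr_const card_ord -mulr_suml.
have -> : \sum_(i < M1) (~~ (i < act)%N)%:R = (M1 - act)%:R :> R.
  apply: (@addrI _ act%:R); rewrite -natrD subnKC//.
  rewrite -{1}[act]card_ord -[X in X%:R + _]sum1_card natr_sum.
  rewrite (@big_ord_widen _ _ _ _ _ (fun=> 1) actM1) big_mkcond /= -big_split /=.
  rewrite (eq_bigr (fun=> 1)) ?sumr_const ?card_ord// => i _.
  by case: (i < act)%N; rewrite /= ?addr0 ?add0r.
rewrite le_eqVlt; apply/orP; left; apply/eqP.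
rewrite natrM -[_ *+ M1]mulr_natl; field.
by rewrite !pnatr_eq0 -!lt0n M10 M2_gt0.
Qed.

End SchemeCode.

(** * Achievability *)

Section Achievability.
Context {R : realType}.

Lemma geometric_le (a z e : R) : 0 <= z < 1 -> 0 < e ->
  exists N0, forall n, (N0 <= n)%N -> a * z ^+ n <= e.
Proof.
move=> /andP[z0 z1] e0.
have /cvgrPdist_le/(_ e e0)[N0 _ H] : geometric a z @ \oo --> 0.
  by apply: cvg_geometric; rewrite ger0_norm.
exists N0 => n /H; rewrite /= sub0r normrN; exact: le_trans (ler_norm _).
Qed.

Lemma ln_natr_ge (x : R) : 0 <= x -> x <= ln (Num.truncn (expR x)).+1%:R.
Proof.
by move=> x0; rewrite -ler_expR lnK ?posrE// ltW// truncnS_gt.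
Qed.

Lemma truncn_expR_le (x : R) : 0 <= x -> (Num.truncn (expR x)).+1%:R <= 2 * expR x.
Proof.
move=> x0; have := truncn_le (expR x); rewrite expR_ge0 -natr1.
have : 1 <= expR x by rewrite -expR0 ler_expR.
lra.
Qed.

(** Rounding the number of messages up to an integer costs only a constant factor, harmless against
    geometric decay. *)
Lemma truncn_expR_sqr_le n (x : R) : 0 <= x ->
  ((Num.truncn (expR (n%:R * x))).+1%:R) ^+ 2 <= 4 * expR (2 * x) ^+ n.
Proof.
move=> x0; have nx0 : 0 <= n%:R * x by rewrite mulr_ge0.
have := truncn_expR_le nx0; set y := _.+1%:R => yle.
have y0 : 0 <= y by [].
have -> : expR (2 * x) ^+ n = expR (n%:R * x) ^+ 2.
  by rewrite -!expRM_natl; congr expR; ring.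
have -> : 4 * expR (n%:R * x) ^+ 2 = (2 * expR (n%:R * x)) ^+ 2 by ring.
by rewrite ler_pXn2r ?nnegrE// (le_trans y0).
Qed.

Lemma region_achievable (P1 P2 s R1 R2 : R) : 0 < P1 -> 0 < P2 -> 0 < s ->
  nofb_region P1 P2 s (R1, R2) -> achievable P1 P2 s R1 R2.
Proof.
move=> P10 P20 s0 [rho [/andP[rho0 rho1] /= R10 R20 H2 H12]].
split=> //; split=> // eps eps0.
have ln20 : 0 < ln 2 :> R by rewrite ln_gt0// ltr1n.
have s20 : 0 < s ^+ 2 by rewrite exprn_gt0.
set S := P1 + P2 + _ in H12.
(* Up to constants, the squared numbers of messages grow like [e1 ^+ N] and [e2 ^+ N]; the scheme
   needs [q ^+ 2 * e1 < 1] and [r ^+ 2 * e2 < 1]. *)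
pose e1 := expR (2 * (R1 * ln 2)); pose e2 := expR (2 * (R2 * ln 2)).
have expR_log2 (x y : R) : 0 < y -> x <= 2^-1 * log2 y -> expR (2 * (x * ln 2)) <= y.
  move=> y0 xy; have : x * ln 2 <= ln y / 2.
    by rewrite -ler_pdivlMr// mulrAC mulrC.
  by move=> xl; rewrite -[leRHS]lnK ?posrE// ler_expR; lra.
have D20 : 0 <= P2 * (1 - rho ^+ 2).
  by apply: mulr_ge0; [exact: ltW|rewrite subr_ge0 expr_le1].
have g0 : 0 <= Num.sqrt (P1 * P2) by exact: sqrtr_ge0.
have S0 : 0 <= S.
  have : 0 <= 2 * Num.sqrt (P1 * P2) * rho by rewrite !mulr_ge0.
  by move: (ltW P10) (ltW P20); rewrite /S; lra.
have e2le : s ^+ 2 * e2 <= s ^+ 2 + P2 * (1 - rho ^+ 2).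
  have -> : s ^+ 2 + P2 * (1 - rho ^+ 2) = s ^+ 2 * (1 + P2 * (1 - rho ^+ 2) / s ^+ 2).
    by field; rewrite gt_eqF.
  by rewrite ler_pM2l// expR_log2// ltr_wpDr// divr_ge0// ltW.
have e12le : s ^+ 2 * (e1 * e2) <= s ^+ 2 + S.
  have -> : s ^+ 2 + S = s ^+ 2 * (1 + S / s ^+ 2) by field; rewrite gt_eqF.
  rewrite ler_pM2l// -expRD -mulrDr -mulrDl expR_log2// ltr_wpDr// divr_ge0//.
  exact: ltW.
have e1_ge1 : 1 <= e1 by rewrite -expR0 ler_expR !mulr_ge0// ltW.
have e2_ge1 : 1 <= e2 by rewrite -expR0 ler_expR !mulr_ge0// ltW.
(* [T0] is the power for which [R2] is exactly the capacity left once message 1 is removed; the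
   remainder [D0] of [P2] helps message 1. Since [D0 >= P2 * rho ^+ 2], the coherent gain [a0 * b0]
   is at least the one granted by [rho]. *)
pose T0 := s ^+ 2 * (e2 - 1); pose D0 := P2 - T0.
have T00 : 0 <= T0 by apply: mulr_ge0; [exact: ltW|rewrite subr_ge0].
have D0ge : P2 * rho ^+ 2 <= D0 by rewrite /D0 /T0; lra.
have D00 : 0 <= D0 by apply: le_trans D0ge; rewrite mulr_ge0 ?sqr_ge0// ltW.
pose a0 := Num.sqrt P1; pose b0 := Num.sqrt D0.
have a00 : 0 < a0 by rewrite sqrtr_gt0.
have b00 : 0 <= b0 by exact: sqrtr_ge0.
have a02 : a0 ^+ 2 = P1 by rewrite sqr_sqrtr// ltW.
have b02 : b0 ^+ 2 = D0 by rewrite sqr_sqrtr.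
have rho_le : Num.sqrt (P1 * P2) * rho <= a0 * b0.
  rewrite sqrtrM ?(ltW P10)// -mulrA ler_pM2l//.
  rewrite -(ler_pXn2r (ltn0Sn 1)) ?nnegrE ?mulr_ge0 ?sqrtr_ge0//.
  by rewrite exprMn b02 sqr_sqrtr// ltW.
have e1le : (s ^+ 2 + T0) * e1 <= s ^+ 2 + T0 + (a0 + b0) ^+ 2.
  have -> : (a0 + b0) ^+ 2 = P1 + D0 + 2 * (a0 * b0) by rewrite -a02 -b02; ring.
  have : (s ^+ 2 + T0) * e1 = s ^+ 2 * (e1 * e2) by rewrite /T0; ring.
  by move: e12le rho_le; rewrite /S /D0; lra.
(* Silencing the fraction [1 / K.+1] of the messages spends half of the error budget [eps]; the two
   geometric terms get a quarter each. *)
pose K := (Num.truncn (2 / eps)).+1.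
have K0 : 0 < K%:R :> R by [].
have Keps : (K.+1)%:R^-1 <= eps / 2.
  rewrite -[leRHS]invrK lef_pV2 ?posrE ?invr_gt0 ?divr_gt0// invf_div.
  apply/ltW/(lt_le_trans (truncnS_gt _)); by rewrite ler_nat.
(* [k] is the power gain obtained by serving the fraction [K / K.+1] of the
   messages; [k'] spreads it so that [k P2 - T = k' D0], leaving both individual
   rates strictly below capacity even when [T0 = 0]. *)
pose k : R := (K.+1)%:R / K%:R.
have k1 : 1 < k by rewrite ltr_pdivlMr// mul1r ltr_nat.
pose k' := (k * P2 + s ^+ 2) / (P2 + s ^+ 2).
have Ps0 : 0 < P2 + s ^+ 2 by rewrite addr_gt0.
have k'1 : 1 < k' by rewrite ltr_pdivlMr// mul1r ltrD2r -{1}[P2]mul1r ltr_pM2r.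
have k'k : k' < k.
  rewrite ltr_pdivrMr// mulrDr ltrD2l -{1}[s ^+ 2]mul1r ltr_pM2r//.
have k'E : k' * (P2 + s ^+ 2) = k * P2 + s ^+ 2 by rewrite /k' divfK// gt_eqF.
pose T := k' * T0 + (k' - 1) * s ^+ 2.
pose v1 := k' * (s ^+ 2 + T0).
have v1E : v1 = T + s ^+ 2 by rewrite /v1 /T; ring.
have k'0 : 0 < k' by apply: lt_trans k'1.
have k0 : 0 < k by apply: lt_trans k1.
have T_gt0 : 0 < T.
  by rewrite ltr_wpDl ?mulr_gt0 ?subr_gt0//; rewrite mulr_ge0// ltW.
have v10 : 0 < v1 by rewrite v1E addr_gt0.
pose A := Num.sqrt k * a0; pose B := Num.sqrt k' * b0.
have A0 : 0 < A by rewrite mulr_gt0// sqrtr_gt0.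
have B0 : 0 <= B by rewrite mulr_ge0// sqrtr_ge0.
have A2 : A ^+ 2 = k * P1 by rewrite exprMn a02 sqr_sqrtr// ltW.
have B2 : B ^+ 2 = k' * D0 by rewrite exprMn b02 sqr_sqrtr// ltW.
pose tau := Num.sqrt T.
have tau0 : 0 < tau by rewrite sqrtr_gt0.
have tau2 : tau ^+ 2 = T by rewrite sqr_sqrtr// ltW.
have BT : B ^+ 2 + tau ^+ 2 = k * P2.
  by rewrite B2 tau2 /T /D0; move: k'E; lra.
pose G := A + B; have G0 : 0 < G by rewrite ltr_wpDr.
pose v2 := G ^+ 2 + v1; have v20 : 0 < v2 by rewrite addr_gt0// exprn_gt0.
(* For uncorrelated states of unit variance the output has variance [v2]. The least-squares gain for
   the first coordinate is [G / v2], with residual variance [v1 / v2]; dividing by [q] restores unit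
   variance. [r] and [t] do the same for the second coordinate, observed in noise [s ^+ 2]. *)
pose q := Num.sqrt (v1 / v2); have q0 : 0 < q by rewrite sqrtr_gt0 divr_gt0.
have q2 : q ^+ 2 = v1 / v2 by rewrite sqr_sqrtr// divr_ge0// ltW.
pose r := Num.sqrt (s ^+ 2 / v1); have r0 : 0 < r by rewrite sqrtr_gt0 divr_gt0.
have r2 : r ^+ 2 = s ^+ 2 / v1 by rewrite sqr_sqrtr// divr_ge0// ltW.
pose g := G / (q * v2); pose t := tau / (r * v1).
have qg : q ^+ 2 + g ^+ 2 * (tau ^+ 2 + s ^+ 2) = 1.
  rewrite tau2 -v1E /g expr_div_n exprMn q2 /v2; field.
  by rewrite -/v2 !gt_eqF.
have rt : r ^+ 2 + t ^+ 2 * s ^+ 2 = 1.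
  rewrite /t expr_div_n exprMn r2 tau2 v1E; field.
  by rewrite -v1E !gt_eqF.
have ts : t * s ^+ 2 = r * tau.
  have -> : s ^+ 2 = r ^+ 2 * v1 by rewrite r2 divfK// gt_eqF.
  by rewrite /t; field; rewrite !gt_eqF.
have qV : q + g * (A + B) = q^-1.
  apply: (mulfI (x := q)); first by rewrite gt_eqF.
  rewrite mulfV ?gt_eqF// mulrDr -expr2 q2 /g -/G.
  have -> : q * (G / (q * v2) * G) = G ^+ 2 / v2 by field; rewrite !gt_eqF.
  by rewrite -mulrDl addrC divff// gt_eqF.
have rV : r + t * tau = r^-1.
  apply: (mulfI (x := r)); first by rewrite gt_eqF.
  rewrite mulfV ?gt_eqF// mulrDr -expr2 r2 /t.
  have -> : r * (tau / (r * v1) * tau) = tau ^+ 2 / v1 by field; rewrite !gt_eqF.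
  by rewrite tau2 -mulrDl addrC -v1E divff// gt_eqF.
have qe1 : q ^+ 2 * e1 < 1.
  rewrite q2 mulrAC ltr_pdivrMr// mul1r /v2.
  (* Strictness comes from [k' < k]: user 1 is amplified by [k], while the effective noise [v1] and
     the coherent part of user 2 grow only by [k']. *)
  have G2 : k' * (a0 + b0) ^+ 2 < G ^+ 2.
    have -> : k' * (a0 + b0) ^+ 2 = (Num.sqrt k' * (a0 + b0)) ^+ 2.
      by rewrite exprMn sqr_sqrtr// ltW.
    have ab0 : 0 <= Num.sqrt k' * (a0 + b0).
      by rewrite mulr_ge0 ?sqrtr_ge0// addr_ge0// ltW.
    rewrite ltr_pXn2r ?nnegrE//; last exact: ltW.
    by rewrite mulrDr ltrD2r ltr_pM2r// ltr_sqrt.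
  have : v1 * e1 <= k' * (s ^+ 2 + T0 + (a0 + b0) ^+ 2).
    by rewrite -mulrA ler_pM2l.
  by rewrite mulrDr -/v1; lra.
have re2 : r ^+ 2 * e2 < 1.
  rewrite r2 mulrAC ltr_pdivrMr// mul1r.
  have -> : s ^+ 2 * e2 = s ^+ 2 + T0 by rewrite /T0; ring.
  by rewrite -[ltLHS]mul1r ltr_pM2r// ltr_wpDr.
have e10 : 0 <= e1 by exact: expR_ge0.
have e20 : 0 <= e2 by exact: expR_ge0.
have [||N1 HN1] := @geometric_le (4 * K%:R ^+ 2) (q ^+ 2 * e1) (eps / 4).
- by rewrite qe1 andbT mulr_ge0 ?sqr_ge0.
- by rewrite divr_gt0.
have [||N2 HN2] := @geometric_le 4 (r ^+ 2 * e2) (eps / 4).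
- by rewrite re2 andbT mulr_ge0 ?sqr_ge0.
- by rewrite divr_gt0.
exists (maxn N1 N2) => N NN N0.
have NR0 : 0 < N%:R :> R by rewrite ltr0n.
have x10 : 0 <= R1 * ln 2 by rewrite mulr_ge0// ltW.
have x20 : 0 <= R2 * ln 2 by rewrite mulr_ge0// ltW.
pose L1 := (Num.truncn (expR (N%:R * (R1 * ln 2)))).+1.
pose M2 := (Num.truncn (expR (N%:R * (R2 * ln 2)))).+1.
have act0 : (0 < K * L1)%N by rewrite muln_gt0.
have actM1 : (K * L1 <= K.+1 * L1)%N by rewrite leq_mul2r leqnSn orbT.
(* Averaging over all messages multiplies the power of the active ones by [k^-1], which undoes the
   factor [k] in [A2] and [BT]. *)
have frac : (K * L1)%:R / (K.+1 * L1)%:R = k^-1 :> R.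
  by rewrite !natrM /k invf_div -mulf_div divff ?mulr1// pnatr_eq0.
have rate (x : R) M : N%:R * (x * ln 2) <= ln M%:R -> x <= log2 M%:R / N%:R.
  by move=> xM; rewrite /log2 ler_pdivlMr// ler_pdivlMr// mulrAC mulrC.
exists (K.+1 * L1)%N, M2, (scheme_code A B tau q g r t N act0 actM1 (ltn0Sn _)).
split; first by rewrite muln_gt0.
split=> //; split.
  apply: rate; apply: le_trans (ln_natr_ge _) _; first by rewrite mulr_ge0.
  rewrite ler_ln ?posrE ?ltr0n ?muln_gt0// ler_nat -/L1.
  by rewrite mulSn leq_addr.
split; first by apply: rate; apply: ln_natr_ge; rewrite mulr_ge0.
split; first exact: scheme_code_measurable.
split.
  apply: le_trans (avg_power1_scheme A B s0 qg rt ts _ _ _ N0) _.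
  by rewrite lee_fin frac A2 mulKf// gt_eqF.
split.
  apply: le_trans (avg_power2_scheme A B s0 qg rt ts _ _ _ N0) _.
  by rewrite lee_fin frac BT mulKf// gt_eqF.
apply: le_trans (@error_prob_scheme R s A B tau q g r t N _ _ _ s0 qg rt ts qV rV q0 r0 _ _ _) _.
rewrite lee_fin.
have -> : (K.+1 * L1 - K * L1)%:R / (K.+1 * L1)%:R = (K.+1)%:R^-1 :> R.
  rewrite mulSn addnK -mulSn natrM invfM mulrCA divff ?mulr1// pnatr_eq0.
  by [].
have b1 : (q ^+ N * (K * L1)%:R) ^+ 2 <= eps / 4.
  apply: le_trans (HN1 N (leq_trans (leq_maxl _ _) NN)).
  have -> : (q ^+ N * (K * L1)%:R) ^+ 2 = (q ^+ 2) ^+ N * K%:R ^+ 2 * L1%:R ^+ 2.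
    by rewrite natrM mulrA [in LHS]exprMn [in LHS]exprMn exprAC.
  apply: le_trans (ler_wpM2l _ (truncn_expR_sqr_le N x10)) _.
    by rewrite mulr_ge0 ?sqr_ge0// exprn_ge0// sqr_ge0.
  rewrite [(q ^+ 2 * e1) ^+ N]exprMn -/e1 le_eqVlt; apply/orP; left; apply/eqP.
  by move: (_ ^+ N) (e1 ^+ N) => x y; ring.
have b2 : (r ^+ N * M2%:R) ^+ 2 <= eps / 4.
  apply: le_trans (HN2 N (leq_trans (leq_maxr _ _) NN)).
  have -> : (r ^+ N * M2%:R) ^+ 2 = (r ^+ 2) ^+ N * M2%:R ^+ 2.
    by rewrite [in LHS]exprMn exprAC.
  apply: le_trans (ler_wpM2l _ (truncn_expR_sqr_le N x20)) _.
    by rewrite exprn_ge0// sqr_ge0.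
  by rewrite [(r ^+ 2 * e2) ^+ N]exprMn -/e2 le_eqVlt mulrCA eqxx.
by apply: le_trans (lerD Keps (lerD b1 b2)) _; lra.
Qed.

End Achievability.

Unset Implicit Arguments.
Set Strict Implicit.

Theorem theorem5 (R : realType) (P1 P2 sigma1 : R) :
  0 < P1 -> 0 < P2 -> 0 < sigma1 ->
  capacity_region_fb P1 P2 sigma1 = nofb_region P1 P2 sigma1.
Proof.
move=> P10 P20 s0; apply/seteqP; split => -[R1 R2].
  exact: achievable_region.
exact: region_achievable.
Qed.
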